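(* Let $h>0$ and let $F(z)=U(x,y)+\mathrm{i}V(x,y)$, $z=x+\mathrm{i}y$, be holomorphic in a neighborhood of the closed strip $\{x+\mathrm{i}y: x\in\mathbb{R},\ 0\le y\le h\}$. Assume that the imaginary component satisfies $$V(x,0)=0,\qquad V(x,h)=g_h(x),\qquad x\in\mathbb{R}.$$ Then, for $x\in\mathbb{R}$ and $0<y<h$, the harmonic reconstruction of $V$ is $$V(x,y)=\left(P_h(\cdot,y)*g_h\right)(x),\qquad P_h(x,y)=\frac{1}{2h}\,\frac{\sin(\pi y/h)}{\cosh(\pi x/h)+\cos(\pi y/h)},$$ where $P_h$ is the Poisson kernel associated with the upper boundary of the strip. The corresponding real component is given, up to an additive constant $C$, by $$U(x,y)=\left(Q_h(\cdot,y)*g_h\right)(x)+C,\qquad Q_h(x,y)=\frac{1}{2h}\,\frac{\sinh(\pi x/h)}{\cosh(\pi x/h)+\cos(\pi y/h)},$$ where $Q_h$ is the conjugate Poisson kernel for the strip. In particular, at the real boundary $y=0$, $$U(x,0)=\left[\frac{1}{2h}\tanh\left(\frac{\pi\,\cdot}{2h}\right)*g_h\right](x)+C=\frac{1}{2h}\int_{-\infty}^{\infty}\tanh\left(\frac{\pi(x-t)}{2h}\right)g_h(t)\,dt+C,\qquad x\in\mathbb{R}.$$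
   Context: $U$ and $V$ are the real and imaginary parts of $F$ and $\mathrm{i}$ is the imaginary unit. Convolution is in the $x$ variable: $\left(K(\cdot,y)*g_h\right)(x)=\int_{-\infty}^{\infty}K(x-t,y)\,g_h(t)\,dt$ for $K=P_h$ or $K=Q_h$. The constant $C$ is a real constant independent of $x$ and $y$.
   Formalization: Adds that V(x,y)=o(exp(π|x|/h)) uniformly in 0≤y≤h (else F=sinh(πz/h) has g_h=0 but V≠0), and, for the formulas for U only, that the improper integral of g_h over R converges (else Q_h*g_h diverges, as for F(z)=z). *)

(* Defs.v *)
From Stdlib Require Import Reals.
From Coquelicot Require Import Coquelicot.
Open Scope R_scope.

Definition closed_strip (h : R) (z : C) : Prop := 0 <= Im z <= h.

(* Coquelicot's [ex_derive] at [C_NormedModule] is complex differentiability. *)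
Definition holomorphic_on (D : C -> Prop) (F : C -> C) : Prop :=
  forall z : C, D z -> ex_derive (K := C_AbsRing) (V := C_NormedModule) F z.

Definition holomorphic_near (S : C -> Prop) (F : C -> C) : Prop :=
  exists D : C -> Prop,
    open D /\ (forall z : C, S z -> D z) /\ holomorphic_on D F.

(* V(x,y) = o(exp(pi |x| / h)) as |x| -> oo, uniformly in 0 <= y <= h: the
   Phragmen-Lindelof condition for a strip of width h.  The exponent is
   critical: the nonzero function sin(pi y / h) cosh(pi x / h), the imaginary
   part of sinh(pi z / h), is harmonic and vanishes on both boundary lines. *)
Definition phragmen_lindelof (h : R) (V : R -> R -> R) : Prop :=
  forall eps : R, 0 < eps ->
  exists A : R, forall x y : R, A <= Rabs x -> 0 <= y <= h ->
    Rabs (V x y) <= eps * exp (PI * Rabs x / h).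

(* Integrals over the line are improper Riemann integrals, the two endpoints
   tending to -oo and +oo independently (not a principal value).  For the
   continuous integrands met here this extends the Lebesgue integral. *)
Definition ex_RInt_line (f : R -> R) : Prop :=
  ex_RInt_gen f (Rbar_locally m_infty) (Rbar_locally p_infty).

Definition RInt_line (f : R -> R) : R :=
  RInt_gen f (Rbar_locally m_infty) (Rbar_locally p_infty).

(* [RInt_line] is unspecified on divergent integrals; [ex_conv] records
   convergence. *)
Definition ex_conv (K g : R -> R) (x : R) : Prop :=
  ex_RInt_line (fun t => K (x - t) * g t).

Definition conv (K g : R -> R) (x : R) : R :=
  RInt_line (fun t => K (x - t) * g t).

Definition poisson_kernel (h x y : R) : R :=
  1 / (2 * h) * (sin (PI * y / h) / (cosh (PI * x / h) + cos (PI * y / h))).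

Definition conj_poisson_kernel (h x y : R) : R :=
  1 / (2 * h) * (sinh (PI * x / h) / (cosh (PI * x / h) + cos (PI * y / h))).

(* Main.v *)
(* With k = PI / h, apply Cauchy's theorem on [a, b] x [- h, h] to
   (F(z) - F(z0)) coth(k (z - z0) / 2), where F is continued by Schwarz
   reflection; this product is bounded near z0.  The coth has period 2 i h, so the
   two horizontal sides combine into an integral of g against
   tanh(k (z0 - t) / 2), whose real and imaginary parts are the two kernels.  On
   the vertical sides the coth tends to 1 and -1 with error O(exp(- k |x|)), and
   only the mean of U over the cross section survives.  U itself is not
   controlled by the growth of V, but M(x, y), the integral of U(x, .) over
   [0, y], is: M(b, y) - M(a, y) is the integral of V(., y) over [a, b], so
   M = o(exp(k |x|)) and integration by parts in y handles the error term.  The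
   imaginary part needs nothing else; for the real part, convergence of the
   integral of g is convergence of M(x, h) at both ends, whence the constant. *)

Require Import Defs.
From Stdlib Require Import Reals Lra Psatz.
From Coquelicot Require Import Coquelicot.
Open Scope R_scope.

(** * Goursat's lemma on rectangles, for real closed forms *)

(** [F] is only known to have a complex derivative at each point, so Cauchy's theorem is obtained by
    Goursat's bisection, applied separately to the real and imaginary parts of [f dz] as real forms.
    The reflected function is never built, which would require differentiability across the real
    axis. The lower half of the contour is instead conjugated onto the upper half, where it becomes
    the integral of a second quotient [G2]; as [G2] is the conjugate of [G1] on the real axis, one
    part of the sum and one part of the difference vanish there, and the rectangle over [0, h] has
    no bottom contribution. Subtracting F(z0) removes the residue: F(z0) comes back from the
    vertical sides, where the subtracted constant meets a coth close to 1 or -1. Two sides of total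
    height 2 h are the origin of the factor 1 / (2 h). The tanh formula needs z0 on the real axis,
    so that case is carried along with the interior one, and the exceptional point may lie on the
    bottom side of the rectangle. *)

Definition rect_int (P Q : R -> R -> R) (a b c d : R) : R :=
  RInt (fun t => P t c) a b - RInt (fun t => P t d) a b
  + RInt (fun s => Q b s) c d - RInt (fun s => Q a s) c d.

(* [P dx + Q dy] is differentiable at [(x, y)] and closed there: the same
   number [q] is the y-derivative of [P] and the x-derivative of [Q]. *)
Definition closed_form_at (P Q : R -> R -> R) (x y : R) : Prop :=
  exists p q r : R, forall eps : R, 0 < eps -> exists delta : R, 0 < delta /\
    forall x' y' : R, Rabs (x' - x) < delta -> Rabs (y' - y) < delta ->
      Rabs (P x' y' - (P x y + p * (x' - x) + q * (y' - y)))
        <= eps * (Rabs (x' - x) + Rabs (y' - y)) /\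
      Rabs (Q x' y' - (Q x y + q * (x' - x) + r * (y' - y)))
        <= eps * (Rabs (x' - x) + Rabs (y' - y)).

Lemma continuous_of_linear_bound (f : R -> R) (x L delta : R) :
  0 < delta ->
  (forall x', Rabs (x' - x) < delta -> Rabs (f x' - f x) <= L * Rabs (x' - x)) ->
  continuous f x.
Proof.
intros Hd H.
apply filterlim_locally; intros eps.
assert (HL : 0 < Rabs L + 1) by (pose proof (Rabs_pos L); lra).
assert (Hm : 0 < Rmin delta (eps / (Rabs L + 1))).
{ apply Rmin_pos; [exact Hd | apply Rdiv_lt_0_compat; [apply cond_pos | exact HL]]. }
exists (mkposreal _ Hm); intros x' Hx'.
unfold ball in *; simpl in *; unfold AbsRing_ball, abs, minus, plus, opp in *; simpl in *.
assert (H1 : Rabs (x' - x) < delta) by (eapply Rlt_le_trans; [exact Hx' | apply Rmin_l]).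
assert (H2 : Rabs (x' - x) < eps / (Rabs L + 1)) by (eapply Rlt_le_trans; [exact Hx' | apply Rmin_r]).
apply Rle_lt_trans with ((Rabs L + 1) * Rabs (x' - x)).
- eapply Rle_trans; [apply (H x' H1) |].
  apply Rmult_le_compat_r; [apply Rabs_pos | pose proof (Rle_abs L); lra].
- apply Rmult_lt_compat_l with (r := Rabs L + 1) in H2; [| exact HL].
  replace ((Rabs L + 1) * (eps / (Rabs L + 1))) with (pos eps) in H2 by (field; lra).
  exact H2.
Qed.

Lemma linear_bound_of_expansion (u v p d : R) :
  Rabs (u - (v + p * d)) <= 1 * Rabs d -> Rabs (u - v) <= (Rabs p + 1) * Rabs d.
Proof.
intros H.
replace (u - v) with ((u - (v + p * d)) + p * d) by ring.
eapply Rle_trans; [apply Rabs_triang |].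
rewrite Rabs_mult; lra.
Qed.

Lemma closed_form_at_continuous (P Q : R -> R -> R) (x y : R) :
  closed_form_at P Q x y ->
  continuous (fun t => P t y) x /\ continuous (fun s => Q x s) y.
Proof.
intros (p & q & r & H).
destruct (H 1 Rlt_0_1) as (d & Hd & H1).
split.
- apply continuous_of_linear_bound with (Rabs p + 1) d; [exact Hd |].
  intros x' Hx'; apply linear_bound_of_expansion.
  destruct (H1 x' y Hx') as [H2 _].
  { rewrite Rminus_diag, Rabs_R0; exact Hd. }
  rewrite Rminus_diag, Rabs_R0, Rmult_0_r, !Rplus_0_r in H2; exact H2.
- apply continuous_of_linear_bound with (Rabs r + 1) d; [exact Hd |].
  intros y' Hy'; apply linear_bound_of_expansion.
  destruct (H1 x y') as [_ H2]; [| exact Hy' |].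
  { rewrite Rminus_diag, Rabs_R0; exact Hd. }
  rewrite Rminus_diag, Rabs_R0, Rmult_0_r, Rplus_0_r, Rplus_0_l in H2; exact H2.
Qed.

Lemma ex_RInt_of_continuous (f : R -> R) (a b : R) :
  a <= b -> (forall t, a <= t <= b -> continuous f t) -> ex_RInt f a b.
Proof.
intros Hab H; apply @ex_RInt_continuous.
intros t Ht; rewrite Rmin_left, Rmax_right in Ht by assumption; apply H, Ht.
Qed.

Lemma closed_form_integrable (P Q : R -> R -> R) (a b c d : R) :
  a <= b -> c <= d ->
  (forall x y, a <= x <= b -> c <= y <= d -> closed_form_at P Q x y) ->
  (forall y, c <= y <= d -> ex_RInt (fun t => P t y) a b) /\
  (forall x, a <= x <= b -> ex_RInt (fun s => Q x s) c d).
Proof.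
intros Hab Hcd H; split; intros z Hz; apply ex_RInt_of_continuous; try assumption;
  intros t Ht.
- apply (closed_form_at_continuous P Q); auto.
- apply (closed_form_at_continuous P Q); auto.
Qed.

Lemma ex_RInt_sub (f : R -> R) (a b a' b' : R) :
  ex_RInt f a b -> a <= a' -> a' <= b' -> b' <= b -> ex_RInt f a' b'.
Proof.
intros H H1 H2 H3.
apply (ex_RInt_Chasles_1 (V := R_CompleteNormedModule)) with b; [lra |].
apply (ex_RInt_Chasles_2 (V := R_CompleteNormedModule)) with a; [lra | exact H].
Qed.

Lemma RInt_Chasles_R (f : R -> R) (a b c : R) :
  ex_RInt f a b -> ex_RInt f b c -> RInt f a c = RInt f a b + RInt f b c.
Proof. intros H1 H2; symmetry; exact (RInt_Chasles f a b c H1 H2). Qed.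

Lemma RInt_plus_R (f g : R -> R) (a b : R) :
  ex_RInt f a b -> ex_RInt g a b ->
  RInt (fun t => f t + g t) a b = RInt f a b + RInt g a b.
Proof. intros H1 H2; exact (RInt_plus f g a b H1 H2). Qed.

Lemma RInt_minus_R (f g : R -> R) (a b : R) :
  ex_RInt f a b -> ex_RInt g a b ->
  RInt (fun t => f t - g t) a b = RInt f a b - RInt g a b.
Proof. intros H1 H2; exact (RInt_minus f g a b H1 H2). Qed.

Lemma RInt_scal_R (c : R) (f : R -> R) (a b : R) :
  ex_RInt f a b -> c * RInt f a b = RInt (fun t => c * f t) a b.
Proof. intros H; symmetry; exact (RInt_scal f a b c H). Qed.

Lemma RInt_ext_R (f g : R -> R) (a b : R) :
  a <= b -> (forall t : R, a < t < b -> f t = g t :> R) -> RInt f a b = RInt g a b.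
Proof.
intros Hab H; apply RInt_ext; intros t Ht.
rewrite Rmin_left, Rmax_right in Ht by exact Hab; exact (H t Ht).
Qed.

Lemma ex_RInt_ext_R (f g : R -> R) (a b : R) :
  a <= b -> (forall t : R, a < t < b -> f t = g t :> R) -> ex_RInt f a b -> ex_RInt g a b.
Proof.
intros Hab H; apply ex_RInt_ext; intros t Ht.
rewrite Rmin_left, Rmax_right in Ht by exact Hab; exact (H t Ht).
Qed.

Lemma RInt_const_R (c a b : R) : RInt (fun _ => c) a b = c * (b - a).
Proof. rewrite RInt_const; unfold scal; simpl; unfold mult; simpl; ring. Qed.

Lemma rect_int_split_x (P Q : R -> R -> R) (a m b c d : R) :
  ex_RInt (fun t => P t c) a m -> ex_RInt (fun t => P t c) m b ->
  ex_RInt (fun t => P t d) a m -> ex_RInt (fun t => P t d) m b ->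
  rect_int P Q a b c d = rect_int P Q a m c d + rect_int P Q m b c d.
Proof.
intros H1 H2 H3 H4; unfold rect_int.
rewrite (RInt_Chasles_R (fun t => P t c) a m b), (RInt_Chasles_R (fun t => P t d) a m b)
  by assumption; ring.
Qed.

Lemma rect_int_split_y (P Q : R -> R -> R) (a b c m d : R) :
  ex_RInt (fun s => Q a s) c m -> ex_RInt (fun s => Q a s) m d ->
  ex_RInt (fun s => Q b s) c m -> ex_RInt (fun s => Q b s) m d ->
  rect_int P Q a b c d = rect_int P Q a b c m + rect_int P Q a b m d.
Proof.
intros H1 H2 H3 H4; unfold rect_int.
rewrite (RInt_Chasles_R (fun s => Q a s) c m d), (RInt_Chasles_R (fun s => Q b s) c m d)
  by assumption; ring.
Qed.

Lemma RInt_diff_const_bound (f g : R -> R) (a b m M : R) :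
  a <= b -> ex_RInt f a b -> ex_RInt g a b ->
  (forall t, a <= t <= b -> Rabs (f t - g t - m) <= M) ->
  Rabs (RInt f a b - RInt g a b - m * (b - a)) <= M * (b - a).
Proof.
intros Hab Hf Hg H.
assert (Hfg : ex_RInt (fun t => f t - g t) a b) by apply (ex_RInt_minus f g a b Hf Hg).
assert (Hm : ex_RInt (fun _ => m) a b) by apply ex_RInt_const.
assert (E : RInt (fun t => f t - g t - m) a b = RInt f a b - RInt g a b - m * (b - a)).
{ rewrite (RInt_minus_R (fun t => f t - g t) (fun _ => m)), RInt_minus_R, RInt_const_R
    by assumption; reflexivity. }
rewrite <- E, Rmult_comm.
apply abs_RInt_le_const; [exact Hab | | exact H].
exact (ex_RInt_minus (fun t => f t - g t) (fun _ => m) a b Hfg Hm).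
Qed.

(** The constant [q] contributes [q * (c - d) * (b - a)] through the horizontal sides and the
    opposite amount through the vertical ones, so only deviations from it count. This cancellation
    is where closedness acts; [q = 0] gives the crude bound for bounded coefficients. *)
Lemma rect_int_bound (P Q : R -> R -> R) (a b c d q M : R) :
  a <= b -> c <= d ->
  ex_RInt (fun t => P t c) a b -> ex_RInt (fun t => P t d) a b ->
  ex_RInt (fun s => Q a s) c d -> ex_RInt (fun s => Q b s) c d ->
  (forall t, a <= t <= b -> Rabs (P t c - P t d - q * (c - d)) <= M) ->
  (forall s, c <= s <= d -> Rabs (Q b s - Q a s - q * (b - a)) <= M) ->
  Rabs (rect_int P Q a b c d) <= M * ((b - a) + (d - c)).
Proof.
intros Hab Hcd H1 H2 H3 H4 HP HQ.
assert (B1 := RInt_diff_const_bound _ _ a b _ M Hab H1 H2 HP).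
assert (B2 := RInt_diff_const_bound _ _ c d _ M Hcd H4 H3 HQ).
replace (rect_int P Q a b c d) with
  ((RInt (fun t => P t c) a b - RInt (fun t => P t d) a b - q * (c - d) * (b - a))
   + (RInt (fun s => Q b s) c d - RInt (fun s => Q a s) c d - q * (b - a) * (d - c)))
  by (unfold rect_int; ring).
eapply Rle_trans; [apply Rabs_triang | lra].
Qed.

Lemma Rabs_in_interval (a b x y : R) :
  a <= x <= b -> a <= y <= b -> Rabs (x - y) <= b - a.
Proof. intros H1 H2; apply Rabs_le; lra. Qed.

(** The affine part of a closed form integrates to zero, and the first-order error times the length
    of the boundary is quadratic in the size. *)
Lemma closed_form_small_rect (P Q : R -> R -> R) (x y : R) :
  closed_form_at P Q x y -> forall eps, 0 < eps -> exists delta, 0 < delta /\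
  forall a b c d, a <= x <= b -> c <= y <= d -> b - a < delta -> d - c < delta ->
    ex_RInt (fun t => P t c) a b -> ex_RInt (fun t => P t d) a b ->
    ex_RInt (fun s => Q a s) c d -> ex_RInt (fun s => Q b s) c d ->
    Rabs (rect_int P Q a b c d) <= eps * ((b - a) + (d - c)) ^ 2.
Proof.
intros (p & q & r & H) eps Heps.
(* Each difference of values on opposite sides involves two expansions. *)
destruct (H (eps / 2)) as (delta & Hdelta & Hd); [lra |].
exists delta; split; [exact Hdelta |].
intros a b c d Hx Hy Hab Hcd H1 H2 H3 H4.
assert (Hle : forall x' y', a <= x' <= b -> c <= y' <= d ->
  Rabs (P x' y' - (P x y + p * (x' - x) + q * (y' - y))) <= eps / 2 * ((b - a) + (d - c)) /\
  Rabs (Q x' y' - (Q x y + q * (x' - x) + r * (y' - y))) <= eps / 2 * ((b - a) + (d - c))).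
{ intros x' y' Hx' Hy'.
  assert (E1 := Rabs_in_interval a b x' x Hx' Hx).
  assert (E2 := Rabs_in_interval c d y' y Hy' Hy).
  destruct (Hd x' y') as [D1 D2]; try lra.
  assert (eps / 2 * (Rabs (x' - x) + Rabs (y' - y)) <= eps / 2 * ((b - a) + (d - c))).
  { apply Rmult_le_compat_l; lra. }
  lra. }
replace (eps * ((b - a) + (d - c)) ^ 2)
  with (eps * ((b - a) + (d - c)) * ((b - a) + (d - c))) by ring.
apply rect_int_bound with q; try assumption; try lra.
- intros t Ht.
  destruct (Hle t c Ht) as [B1 _]; [lra |].
  destruct (Hle t d Ht) as [B2 _]; [lra |].
  apply Rabs_le_between in B1, B2; apply Rabs_le; lra.
- intros s Hs.
  destruct (Hle a s) as [_ B1]; [lra | lra |].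
  destruct (Hle b s) as [_ B2]; [lra | lra |].
  apply Rabs_le_between in B1, B2; apply Rabs_le; lra.
Qed.

Lemma nested_intervals (a b : nat -> R) :
  (forall n, a n <= a (S n)) -> (forall n, b (S n) <= b n) ->
  (forall n, a n <= b n) -> exists x, forall n, a n <= x <= b n.
Proof.
intros Ha Hb Hab.
assert (Ha' : forall n m, (n <= m)%nat -> a n <= a m).
{ intros n m H; induction H; [lra | specialize (Ha m); lra]. }
assert (Hb' : forall n m, (n <= m)%nat -> b m <= b n).
{ intros n m H; induction H; [lra | specialize (Hb m); lra]. }
assert (Hc : forall n m, a n <= b m).
{ intros n m.
  apply Rle_trans with (a (max n m)); [apply Ha', PeanoNat.Nat.le_max_l |].
  apply Rle_trans with (b (max n m)); [apply Hab | apply Hb', PeanoNat.Nat.le_max_r]. }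
destruct (completeness (fun x => exists n, x = a n)) as [x [Hx1 Hx2]].
- exists (b O); intros z [n ->]; apply Hc.
- exists (a O); exists O; reflexivity.
- exists x; intros n; split.
  + apply Hx1; exists n; reflexivity.
  + apply Hx2; intros z [m ->]; apply Hc.
Qed.

(** The hypothesis on [Phi] is subadditivity under quartering, so some quarter inherits positivity
    at each stage. The common ratio [l] records that the rectangles stay similar to the first one,
    which makes a bound quadratic in the size comparable with the area. *)
Lemma rect_bisection (Phi : R -> R -> R -> R -> R) (a b c d : R) :
  a <= b -> c <= d ->
  (forall a' b' c' d', a <= a' -> a' <= b' -> b' <= b -> c <= c' -> c' <= d' -> d' <= d ->
     Phi a' b' c' d' <=
       Phi a' ((a' + b') / 2) c' ((c' + d') / 2) + Phi ((a' + b') / 2) b' c' ((c' + d') / 2)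
       + (Phi a' ((a' + b') / 2) ((c' + d') / 2) d'
          + Phi ((a' + b') / 2) b' ((c' + d') / 2) d')) ->
  0 < Phi a b c d ->
  exists x y, a <= x <= b /\ c <= y <= d /\ forall delta, 0 < delta ->
  exists l a' b' c' d', 0 < l /\ b' - a' = l * (b - a) /\ d' - c' = l * (d - c) /\
    b' - a' < delta /\ d' - c' < delta /\
    a <= a' <= x /\ x <= b' <= b /\ c <= c' <= y /\ y <= d' <= d /\ 0 < Phi a' b' c' d'.
Proof.
intros Hab Hcd Hsub Hpos.
pose (step := fun r : (R * R) * (R * R) =>
  let '((a', b'), (c', d')) := r in
  let m := (a' + b') / 2 in let n := (c' + d') / 2 in
  if Rlt_dec 0 (Phi a' m c' n) then ((a', m), (c', n)) else
  if Rlt_dec 0 (Phi m b' c' n) then ((m, b'), (c', n)) else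
  (* The fourth quarter is the default: if the other three fail, subadditivity makes it positive. *)
  if Rlt_dec 0 (Phi a' m n d') then ((a', m), (n, d')) else ((m, b'), (n, d'))).
pose (rs := fix rs n := match n with O => ((a, b), (c, d)) | S n => step (rs n) end).
pose (good := fun n (r : (R * R) * (R * R)) =>
  let '((a', b'), (c', d')) := r in
  a <= a' /\ b' <= b /\ c <= c' /\ d' <= d /\
  b' - a' = (/ 2) ^ n * (b - a) /\ d' - c' = (/ 2) ^ n * (d - c) /\ 0 < Phi a' b' c' d').
assert (Hpow : forall n, 0 < (/ 2) ^ n) by (intros n; apply pow_lt; lra).
assert (Hstep : forall n r, good n r -> good (S n) (step r) /\
  fst (fst r) <= fst (fst (step r)) /\ snd (fst (step r)) <= snd (fst r) /\
  fst (snd r) <= fst (snd (step r)) /\ snd (snd (step r)) <= snd (snd r)).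
{ intros n [[a' b'] [c' d']] (G1 & G2 & G3 & G4 & G5 & G6 & G7).
  assert (0 <= b' - a') by (rewrite G5; apply Rmult_le_pos; [apply Rlt_le, Hpow | lra]).
  assert (0 <= d' - c') by (rewrite G6; apply Rmult_le_pos; [apply Rlt_le, Hpow | lra]).
  assert (Hs := Hsub a' b' c' d').
  unfold step, good; simpl pow.
  repeat destruct Rlt_dec; simpl; repeat split; try lra. }
assert (Hgood : forall n, good n (rs n)).
{ induction n as [| n IH]; [| apply Hstep, IH].
  simpl; repeat split; simpl; lra. }
assert (Hord : forall n, fst (fst (rs n)) <= snd (fst (rs n)) /\
                         fst (snd (rs n)) <= snd (snd (rs n))).
{ intros n; specialize (Hgood n); destruct (rs n) as [[a' b'] [c' d']].
  destruct Hgood as (G1 & G2 & G3 & G4 & G5 & G6 & G7); simpl.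
  assert (0 <= b' - a') by (rewrite G5; apply Rmult_le_pos; [apply Rlt_le, Hpow | lra]).
  assert (0 <= d' - c') by (rewrite G6; apply Rmult_le_pos; [apply Rlt_le, Hpow | lra]).
  lra. }
destruct (nested_intervals (fun n => fst (fst (rs n))) (fun n => snd (fst (rs n)))) as [x Hx].
{ intros n; apply (Hstep n (rs n) (Hgood n)). }
{ intros n; apply (Hstep n (rs n) (Hgood n)). }
{ apply Hord. }
destruct (nested_intervals (fun n => fst (snd (rs n))) (fun n => snd (snd (rs n)))) as [y Hy].
{ intros n; apply (Hstep n (rs n) (Hgood n)). }
{ intros n; apply (Hstep n (rs n) (Hgood n)). }
{ apply Hord. }
exists x, y; split; [exact (Hx O) | split; [exact (Hy O) |]].
intros delta Hdelta.
assert (HD : 0 < delta / ((b - a) + (d - c) + 1)) by (apply Rdiv_lt_0_compat; lra).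
destruct (pow_lt_1_zero (/ 2)) with (y := delta / ((b - a) + (d - c) + 1)) as [N HN];
  [rewrite Rabs_right; lra | exact HD |].
specialize (HN N (le_n N)); rewrite Rabs_right in HN by (apply Rle_ge, Rlt_le, Hpow).
specialize (Hgood N); specialize (Hx N); specialize (Hy N); specialize (Hpow N).
destruct (rs N) as [[a' b'] [c' d']].
destruct Hgood as (G1 & G2 & G3 & G4 & G5 & G6 & G7); simpl in Hx, Hy.
assert (Hs : (/ 2) ^ N * ((b - a) + (d - c) + 1) < delta).
{ apply Rmult_lt_compat_r with (r := (b - a) + (d - c) + 1) in HN; [| lra].
  replace (delta / ((b - a) + (d - c) + 1) * ((b - a) + (d - c) + 1)) with delta in HN
    by (field; lra).
  exact HN. }
exists ((/ 2) ^ N), a', b', c', d'.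
assert (0 <= (/ 2) ^ N * (b - a)) by (apply Rmult_le_pos; lra).
assert (0 <= (/ 2) ^ N * (d - c)) by (apply Rmult_le_pos; lra).
repeat split; try lra; assumption.
Qed.

(** The absolute value of the integral is subadditive and the area additive, so bisection applies to
    |integral| - [e] * area. It would produce arbitrarily small rectangles around one point with
    |integral| > [e] * area, against the quadratic bound at that point. *)
Theorem goursat (P Q : R -> R -> R) (a b c d : R) :
  a <= b -> c <= d ->
  (forall x y, a <= x <= b -> c <= y <= d -> closed_form_at P Q x y) ->
  rect_int P Q a b c d = 0.
Proof.
intros Hab Hcd H.
destruct (closed_form_integrable P Q a b c d Hab Hcd H) as [IP IQ].
destruct (Req_dec (rect_int P Q a b c d) 0) as [| Hne]; [assumption | exfalso].
destruct (Rle_lt_or_eq_dec a b Hab) as [Hab' |];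
  [| subst; apply Hne; unfold rect_int; rewrite !RInt_point; unfold zero; simpl; ring].
destruct (Rle_lt_or_eq_dec c d Hcd) as [Hcd' |];
  [| subst; apply Hne; unfold rect_int; rewrite !RInt_point; unfold zero; simpl; ring].
assert (Harea : 0 < (b - a) * (d - c)) by (apply Rmult_lt_0_compat; lra).
apply Rabs_pos_lt in Hne.
(* Half the ratio of |integral| to area, so that the bisected quantity starts at half of
   |integral|. *)
pose (e := Rabs (rect_int P Q a b c d) / (2 * ((b - a) * (d - c)))).
assert (He : 0 < e) by (apply Rdiv_lt_0_compat; lra).
destruct (rect_bisection
  (fun a' b' c' d' => Rabs (rect_int P Q a' b' c' d') - e * ((b' - a') * (d' - c'))) a b c d)
  as (x & y & Hx & Hy & Hxy); try assumption.
- intros a' b' c' d' H1 H2 H3 H4 H5 H6.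
  set (m := (a' + b') / 2); set (n := (c' + d') / 2).
  assert (Hm : a' <= m <= b') by (unfold m; lra).
  assert (Hn : c' <= n <= d') by (unfold n; lra).
  assert (JP : forall u v y, a <= u -> u <= v -> v <= b -> c <= y <= d ->
            ex_RInt (fun t => P t y) u v).
  { intros u v y ? ? ? Hy; exact (ex_RInt_sub _ a b u v (IP y Hy) H0 H7 H8). }
  assert (JQ : forall u v x, c <= u -> u <= v -> v <= d -> a <= x <= b ->
            ex_RInt (fun s => Q x s) u v).
  { intros u v x ? ? ? Hx; exact (ex_RInt_sub _ c d u v (IQ x Hx) H0 H7 H8). }
  rewrite (rect_int_split_x P Q a' m b' c' d') by (apply JP; lra).
  rewrite (rect_int_split_y P Q a' m c' n d') by (apply JQ; lra).
  rewrite (rect_int_split_y P Q m b' c' n d') by (apply JQ; lra).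
  assert (T1 := Rabs_triang (rect_int P Q a' m c' n + rect_int P Q a' m n d')
                  (rect_int P Q m b' c' n + rect_int P Q m b' n d')).
  assert (T2 := Rabs_triang (rect_int P Q a' m c' n) (rect_int P Q a' m n d')).
  assert (T3 := Rabs_triang (rect_int P Q m b' c' n) (rect_int P Q m b' n d')).
  unfold m, n in *; nra.
- assert (E : e * ((b - a) * (d - c)) = Rabs (rect_int P Q a b c d) / 2)
    by (unfold e; field; lra).
  rewrite E; lra.
- pose (S := (b - a) + (d - c)).
  assert (HS : 0 < S ^ 2) by (apply pow_lt; unfold S; lra).
  (* With [S] the half-perimeter, this tolerance times the squared half-perimeter of a similar
     rectangle is exactly [e] times its area. *)
  destruct (closed_form_small_rect P Q x y (H x y Hx Hy)
              (e * ((b - a) * (d - c)) / (S ^ 2))) as (delta & Hdelta & Hd).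
  { apply Rdiv_lt_0_compat; [apply Rmult_lt_0_compat; assumption | exact HS]. }
  destruct (Hxy delta Hdelta)
    as (l & a' & b' & c' & d' & Hl & E1 & E2 & D1 & D2 & B1 & B2 & B3 & B4 & Hphi).
  assert (Hb := Hd a' b' c' d').
  assert (F : e * ((b - a) * (d - c)) / S ^ 2 * ((b' - a') + (d' - c')) ^ 2
              = e * ((b' - a') * (d' - c'))).
  { rewrite E1, E2; unfold S; field; unfold S in HS.
    intros E0; rewrite E0 in HS; simpl in HS; lra. }
  rewrite F in Hb.
  enough (Rabs (rect_int P Q a' b' c' d') <= e * ((b' - a') * (d' - c'))) by lra.
  apply Hb; try lra.
  + apply (ex_RInt_sub _ a b); try apply IP; lra.
  + apply (ex_RInt_sub _ a b); try apply IP; lra.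
  + apply (ex_RInt_sub _ c d); try apply IQ; lra.
  + apply (ex_RInt_sub _ c d); try apply IQ; lra.
Qed.

Lemma Req_0_of_Rabs_le (x K delta0 : R) :
  0 < delta0 -> (forall delta, 0 < delta -> delta < delta0 -> Rabs x <= K * delta) -> x = 0.
Proof.
intros Hd H.
destruct (Req_dec x 0) as [| Hx]; [assumption | exfalso].
apply Rabs_pos_lt in Hx.
assert (HK : 0 < K + 1).
{ assert (H1 := H (delta0 / 2)). nra. }
pose (e := Rmin (delta0 / 2) (Rabs x / (2 * (K + 1)))).
assert (He : 0 < e) by (apply Rmin_pos; [lra | apply Rdiv_lt_0_compat; lra]).
assert (E1 : e <= delta0 / 2) by apply Rmin_l.
assert (E2 : e <= Rabs x / (2 * (K + 1))) by apply Rmin_r.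
specialize (H e He).
apply Rmult_le_compat_r with (r := K + 1) in E2; [| lra].
replace (Rabs x / (2 * (K + 1)) * (K + 1)) with (Rabs x / 2) in E2 by (field; lra).
lra.
Qed.

Lemma rect_int_flat (P Q : R -> R -> R) (a b c : R) : rect_int P Q a b c c = 0.
Proof. unfold rect_int; rewrite !RInt_point; unfold zero; simpl; ring. Qed.

(* Asking [P] to vanish on the bottom side makes the boundary integral
   meaningful even when the exceptional point lies on that side. *)
Theorem goursat_punctured (P Q : R -> R -> R) (a b c d x0 y0 M delta0 : R) :
  a < x0 < b -> c <= y0 < d ->
  (forall x y, a <= x <= b -> c <= y <= d -> x <> x0 \/ y <> y0 -> closed_form_at P Q x y) ->
  0 < delta0 ->
  (forall x y, Rabs (x - x0) <= delta0 -> Rabs (y - y0) <= delta0 ->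
     Rabs (P x y) <= M /\ Rabs (Q x y) <= M) ->
  (forall t, P t c = 0) ->
  rect_int P Q a b c d = 0.
Proof.
intros Hx0 Hy0 H Hd0 HM Hbot.
assert (IPc : forall u v, ex_RInt (fun t => P t c) u v).
{ intros u v; apply (ex_RInt_ext (fun _ => 0)); [| apply ex_RInt_const].
  intros t _; symmetry; apply Hbot. }
assert (IP : forall u v y, a <= u -> u <= v -> v <= b -> c <= y <= d ->
          y <> y0 -> ex_RInt (fun t => P t y) u v).
{ intros u v y ? ? ? ? ?; apply ex_RInt_of_continuous; [assumption |].
  intros t Ht; apply (closed_form_at_continuous P Q), H; try lra; right; assumption. }
assert (IQ : forall u v x, c <= u -> u <= v -> v <= d -> a <= x <= b ->
          x <> x0 -> ex_RInt (fun s => Q x s) u v).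
{ intros u v x ? ? ? ? ?; apply ex_RInt_of_continuous; [assumption |].
  intros t Ht; apply (closed_form_at_continuous P Q), H; try lra; left; assumption. }
pose (e := Rmin delta0 (Rmin (Rmin (x0 - a) (b - x0)) (d - y0))).
assert (He : 0 < e) by (repeat apply Rmin_pos; lra).
(* Everything reduces to a box of half-perimeter at most [4 * delta], on which values of one
   coefficient differ by at most [2 * M]. *)
apply Req_0_of_Rabs_le with (2 * M * 4) e; [exact He |].
intros delta Hdelta Hlt.
assert (L1 : e <= delta0) by apply Rmin_l.
assert (L2 : e <= Rmin (Rmin (x0 - a) (b - x0)) (d - y0)) by apply Rmin_r.
assert (L3 := Rmin_l (Rmin (x0 - a) (b - x0)) (d - y0)).
assert (L4 := Rmin_r (Rmin (x0 - a) (b - x0)) (d - y0)).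
assert (L5 := Rmin_l (x0 - a) (b - x0)).
assert (L6 := Rmin_r (x0 - a) (b - x0)).
set (a1 := x0 - delta); set (b1 := x0 + delta); set (d1 := y0 + delta).
assert (Ha1 : a < a1 < x0) by (unfold a1; lra).
assert (Hb1 : x0 < b1 < b) by (unfold b1; lra).
assert (Hd1 : y0 < d1 < d) by (unfold d1; lra).
(* The box is cut off at the bottom side. Either it rests on that side, and the rectangle below it
   is flat, or [c1 < y0] and that rectangle avoids the exceptional point. *)
assert (exists c1, c <= c1 <= y0 /\ y0 - delta <= c1 /\ (c1 = c \/ c1 < y0))
  as (c1 & Hc1 & Hc1' & Hc1'').
{ destruct (Rle_lt_dec (y0 - delta) c).
  - exists c; repeat split; try lra; left; reflexivity.
  - exists (y0 - delta); repeat split; try lra; right; lra. }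
rewrite (rect_int_split_x P Q a a1 b c d) by (auto; apply IP; lra).
rewrite (rect_int_split_x P Q a1 b1 b c d) by (auto; apply IP; lra).
rewrite (rect_int_split_y P Q a1 b1 c c1 d) by (apply IQ; lra).
rewrite (rect_int_split_y P Q a1 b1 c1 d1 d) by (apply IQ; lra).
rewrite (goursat P Q a a1 c d), (goursat P Q b1 b c d), (goursat P Q a1 b1 d1 d);
  try lra; try (intros x y Hx Hy; apply H; lra).
replace (rect_int P Q a1 b1 c c1) with 0.
2: { symmetry; destruct Hc1'' as [-> | Hlt1]; [apply rect_int_flat |].
     apply goursat; try lra; intros x y Hx Hy; apply H; lra. }
rewrite Rplus_0_l, Rplus_0_l, !Rplus_0_r.
assert (HMpos : 0 <= M).
{ destruct (HM x0 y0) as [HM0 _]; try (rewrite Rminus_diag, Rabs_R0; lra).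
  pose proof (Rabs_pos (P x0 y0)); lra. }
assert (Hbox : forall x y, a1 <= x <= b1 -> c1 <= y <= d1 ->
  Rabs (P x y) <= M /\ Rabs (Q x y) <= M).
{ intros x y Hx Hy; apply HM; apply Rabs_le; unfold a1, b1, d1 in *; lra. }
apply Rle_trans with (2 * M * ((b1 - a1) + (d1 - c1))).
- apply rect_int_bound with 0; try lra.
  + destruct Hc1'' as [-> | Hlt1]; [apply IPc | apply IP; lra].
  + apply IP; lra.
  + apply IQ; lra.
  + apply IQ; lra.
  + intros t Ht.
    destruct (Hbox t c1 Ht) as [B1 _]; [lra |].
    destruct (Hbox t d1 Ht) as [B2 _]; [lra |].
    apply Rabs_le_between in B1, B2; apply Rabs_le; lra.
  + intros s Hs.
    destruct (Hbox a1 s) as [_ B1]; [lra | lra |].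
    destruct (Hbox b1 s) as [_ B2]; [lra | lra |].
    apply Rabs_le_between in B1, B2; apply Rabs_le; lra.
- assert ((b1 - a1) + (d1 - c1) <= 4 * delta) by (unfold a1, b1, d1; lra).
  nra.
Qed.

(** * Complex derivatives and the exponential *)

(* [C_NormedModule] and [AbsRing_NormedModule C_AbsRing] carry different uniform
   structures; Coquelicot's product and chain rules need the second one. *)
Definition is_Cderive (f : C -> C) (z l : C) : Prop :=
  @is_derive C_AbsRing (AbsRing_NormedModule C_AbsRing) f z l.

Lemma is_Cderive_eps (f : C -> C) (z l : C) :
  is_Cderive f z l <->
  forall eps, 0 < eps -> exists delta, 0 < delta /\ forall w, Cmod (w - z) < delta ->
    Cmod (f w - f z - (w - z) * l) <= eps * Cmod (w - z).
Proof.
split.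
- intros [_ H] eps Heps.
  assert (Hz : is_filter_lim (locally (T := AbsRing_UniformSpace C_AbsRing) z) z)
    by (intros P HP; exact HP).
  destruct (H z Hz (mkposreal eps Heps)) as [delta Hd].
  exists delta; split; [apply cond_pos |].
  intros w Hw; exact (Hd w Hw).
- intros H; split; [exact (is_linear_scal_l (V := AbsRing_NormedModule C_AbsRing) l) |].
  intros x Hx.
  assert (x = z) as -> by (symmetry; apply (@is_filter_lim_locally_unique
    C_AbsRing (AbsRing_NormedModule C_AbsRing)); exact Hx).
  intros eps; destruct (H eps (cond_pos eps)) as (delta & Hd & Hw).
  exists (mkposreal delta Hd); intros w Hb; exact (Hw w Hb).
Qed.

(** Both notions use the same neighbourhood filter on the domain and the norm [Cmod], so the epsilon
    form of the derivative carries over although the uniform structures of the targets differ. *)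
Lemma ex_Cderive_of_ex_derive (f : C -> C) (z : C) :
  ex_derive (K := C_AbsRing) (V := C_NormedModule) f z -> exists l, is_Cderive f z l.
Proof.
intros [l [_ H]]; exists l; apply is_Cderive_eps; intros eps Heps.
assert (Hz : is_filter_lim (locally (T := AbsRing_UniformSpace C_AbsRing) z) z)
  by (intros P HP; exact HP).
destruct (H z Hz (mkposreal eps Heps)) as [delta Hd].
exists delta; split; [apply cond_pos |].
intros w Hw; exact (Hd w Hw).
Qed.

Lemma is_Cderive_const (c z : C) : is_Cderive (fun _ => c) z 0%C.
Proof. exact (is_derive_const (V := AbsRing_NormedModule C_AbsRing) c z). Qed.

Lemma is_Cderive_plus (f g : C -> C) (z l m : C) :
  is_Cderive f z l -> is_Cderive g z m -> is_Cderive (fun w => f w + g w)%C z (l + m)%C.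
Proof. intros Hf Hg; exact (is_derive_plus (V := AbsRing_NormedModule C_AbsRing) f g z l m Hf Hg). Qed.

Lemma is_Cderive_minus (f g : C -> C) (z l m : C) :
  is_Cderive f z l -> is_Cderive g z m -> is_Cderive (fun w => f w - g w)%C z (l - m)%C.
Proof. intros Hf Hg; exact (is_derive_minus (V := AbsRing_NormedModule C_AbsRing) f g z l m Hf Hg). Qed.

Lemma is_Cderive_mult (f g : C -> C) (z l m : C) :
  is_Cderive f z l -> is_Cderive g z m ->
  is_Cderive (fun w => f w * g w)%C z (l * g z + f z * m)%C.
Proof.
intros Hf Hg; exact (is_derive_mult (K := C_AbsRing) f g z l m Hf Hg Cmult_comm).
Qed.

Lemma is_Cderive_comp (f g : C -> C) (z l m : C) :
  is_Cderive f (g z) l -> is_Cderive g z m -> is_Cderive (fun w => f (g w)) z (m * l)%C.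
Proof.
intros Hf Hg.
exact (is_derive_comp (K := C_AbsRing) (V := AbsRing_NormedModule C_AbsRing) f g z l m Hf Hg).
Qed.

Lemma is_Cderive_affine (a b z : C) : is_Cderive (fun w => a * (w - b))%C z a.
Proof.
apply is_Cderive_eps; intros eps Heps; exists 1; split; [lra |]; intros w _.
replace (a * (w - b) - a * (z - b) - (w - z) * a)%C with (RtoC 0) by ring.
rewrite Cmod_0; apply Rmult_le_pos; [lra | apply Cmod_ge_0].
Qed.

Lemma is_Cderive_lipschitz (f : C -> C) (z l : C) :
  is_Cderive f z l -> exists delta, 0 < delta /\ forall w, Cmod (w - z) < delta ->
    Cmod (f w - f z) <= (Cmod l + 1) * Cmod (w - z).
Proof.
intros H; apply is_Cderive_eps with (eps := 1) in H; [| lra].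
destruct H as (delta & Hd & H); exists delta; split; [exact Hd |].
intros w Hw; specialize (H w Hw).
replace (f w - f z)%C with ((f w - f z - (w - z) * l) + (w - z) * l)%C by ring.
eapply Rle_trans; [apply Cmod_triangle |].
rewrite Cmod_mult; lra.
Qed.

Lemma is_Cderive_bounded (f : C -> C) (z l : C) :
  is_Cderive f z l -> exists delta M, 0 < delta /\ forall w, Cmod (w - z) < delta ->
    Cmod (f w) <= M.
Proof.
intros H; destruct (is_Cderive_lipschitz f z l H) as (delta & Hd & Hl).
exists delta, ((Cmod l + 1) * delta + Cmod (f z)); split; [exact Hd |].
intros w Hw; specialize (Hl w Hw).
replace (f w) with ((f w - f z) + f z)%C by ring.
eapply Rle_trans; [apply Cmod_triangle |].
apply Rplus_le_compat_r, Rle_trans with (1 := Hl).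
apply Rmult_le_compat_l; [pose proof (Cmod_ge_0 l) |]; lra.
Qed.

(** The remainder is exactly (w - z)^2 / (w z^2). The first bound on the radius gives |w| >= |z| /
    2, and the second then makes the quotient at most [eps] times |w - z|. *)
Lemma is_Cderive_inv (z : C) : z <> 0%C -> is_Cderive Cinv z (- / (z * z))%C.
Proof.
intros Hz; apply is_Cderive_eps; intros eps Heps.
assert (Hm : 0 < Cmod z) by (apply Cmod_gt_0; exact Hz).
exists (Rmin (Cmod z / 2) (eps * Cmod z ^ 3 / 2)); split.
{ apply Rmin_pos; [lra |].
  apply Rdiv_lt_0_compat; [apply Rmult_lt_0_compat; [lra | apply pow_lt, Hm] | lra]. }
intros w Hw.
assert (H1 := Rlt_le_trans _ _ _ Hw (Rmin_l _ _)).
assert (H2 := Rlt_le_trans _ _ _ Hw (Rmin_r _ _)).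
assert (Hw' : Cmod z / 2 <= Cmod w).
{ assert (T := Cmod_triangle w (- (w - z))).
  replace (w + - (w - z))%C with z in T by ring.
  rewrite Cmod_opp in T; lra. }
assert (Hw0 : w <> 0%C) by (apply Cmod_gt_0; lra).
replace (/ w - / z - (w - z) * - / (z * z))%C
  with ((w - z) * (w - z) * / (w * (z * z)))%C by (field; split; assumption).
rewrite !Cmod_mult, Cmod_inv, !Cmod_mult by (repeat apply Cmult_neq_0; assumption).
set (d := Cmod (w - z)) in *; set (m := Cmod z) in *; set (n := Cmod w) in *.
assert (Hd : 0 <= d) by apply Cmod_ge_0.
assert (Hn : 0 < n * (m * m)) by (repeat apply Rmult_lt_0_compat; lra).
apply Rmult_le_reg_r with (n * (m * m)); [exact Hn |].
replace (d * d * / (n * (m * m)) * (n * (m * m))) with (d * d) by (field; lra).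
assert (eps * m ^ 3 / 2 <= eps * (n * (m * m))).
{ replace (eps * m ^ 3 / 2) with (eps * (m * m) * (m / 2)) by field.
  replace (eps * (n * (m * m))) with (eps * (m * m) * n) by ring.
  apply Rmult_le_compat_l; [| lra].
  repeat apply Rmult_le_pos; lra. }
nra.
Qed.

Definition Cexp (z : C) : C := (exp (Re z) * cos (Im z), exp (Re z) * sin (Im z)).

Lemma Cexp_plus (z w : C) : Cexp (z + w) = (Cexp z * Cexp w)%C.
Proof.
destruct z as [a b], w as [c d]; unfold Cexp, Cmult, Cplus; simpl.
rewrite exp_plus, cos_plus, sin_plus; f_equal; ring.
Qed.

Lemma Cmod_le_Rabs (z : C) : Cmod z <= Rabs (Re z) + Rabs (Im z).
Proof.
destruct z as [a b]; simpl.
replace (a, b) with (RtoC a + Ci * RtoC b)%C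
  by (unfold Cplus, Cmult, RtoC, Ci; simpl; f_equal; ring).
eapply Rle_trans; [apply Cmod_triangle |].
rewrite Cmod_mult, Cmod_Ci, !Cmod_R; lra.
Qed.

Lemma im_le_Cmod (z : C) : Rabs (Im z) <= Cmod z.
Proof. eapply Rle_trans; [| apply Rmax_Cmod]; apply Rmax_r. Qed.

Lemma derivable_pt_lim_eps (f : R -> R) (l : R) :
  derivable_pt_lim f 0 l -> forall eps, 0 < eps -> exists delta, 0 < delta /\
  forall t, Rabs t < delta -> Rabs (f t - f 0 - l * t) <= eps * Rabs t.
Proof.
intros H eps Heps; destruct (H eps Heps) as [delta Hd].
exists delta; split; [apply cond_pos |]; intros t Ht.
destruct (Req_dec t 0) as [-> | Ht0].
{ replace (f 0 - f 0 - l * 0) with 0 by ring; rewrite Rabs_R0; lra. }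
specialize (Hd t Ht0 Ht); rewrite Rplus_0_l in Hd.
replace (f t - f 0 - l * t) with (((f t - f 0) / t - l) * t) by (field; exact Ht0).
rewrite Rabs_mult; apply Rmult_le_compat_r; [apply Rabs_pos | lra].
Qed.

(** The real derivatives of [exp], [cos] and [sin] at 0 suffice, through e^a cos b - 1 - a = e^a
    (cos b - 1) + (e^a - 1 - a) and e^a sin b - b = e^a (sin b - b) + (e^a - 1) b. The last product
    is of second order, whence the extra radius [eps / 12]; the radius [1/2] keeps e^a below 2. *)
Lemma is_Cderive_exp_0 : is_Cderive Cexp 0%C 1%C.
Proof.
apply is_Cderive_eps; intros eps Heps.
destruct (derivable_pt_lim_eps exp 1) with (eps := Rmin 1 (eps / 12)) as (d1 & Hd1 & H1).
{ pose proof (derivable_pt_lim_exp 0) as D; rewrite exp_0 in D; exact D. }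
{ apply Rmin_pos; lra. }
destruct (derivable_pt_lim_eps cos 0) with (eps := eps / 12) as (d2 & Hd2 & H2).
{ pose proof (derivable_pt_lim_cos 0) as D; rewrite sin_0, Ropp_0 in D; exact D. }
{ lra. }
destruct (derivable_pt_lim_eps sin 1) with (eps := eps / 12) as (d3 & Hd3 & H3).
{ pose proof (derivable_pt_lim_sin 0) as D; rewrite cos_0 in D; exact D. }
{ lra. }
exists (Rmin (Rmin d1 (Rmin d2 d3)) (Rmin (1/2) (eps / 12))); split.
{ repeat apply Rmin_pos; lra. }
intros w Hw.
replace (w - 0)%C with w in * by ring.
assert (M1 := Rmin_l (Rmin d1 (Rmin d2 d3)) (Rmin (1/2) (eps / 12))).
assert (M2 := Rmin_r (Rmin d1 (Rmin d2 d3)) (Rmin (1/2) (eps / 12))).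
assert (M3 := Rmin_l d1 (Rmin d2 d3)); assert (M4 := Rmin_r d1 (Rmin d2 d3)).
assert (M5 := Rmin_l d2 d3); assert (M6 := Rmin_r d2 d3).
assert (M7 := Rmin_l (1/2) (eps / 12)); assert (M8 := Rmin_r (1/2) (eps / 12)).
assert (N1 := Rmin_l 1 (eps / 12)); assert (N2 := Rmin_r 1 (eps / 12)).
assert (Ra := re_le_Cmod w); assert (Rb := im_le_Cmod w).
destruct w as [a b]; unfold Re, Im in Ra, Rb; simpl in Ra, Rb.
set (m := Cmod (a, b)) in *.
specialize (H1 a); specialize (H2 b); specialize (H3 b).
rewrite exp_0 in H1; rewrite cos_0 in H2; rewrite sin_0 in H3.
assert (A1 : Rabs (exp a - 1 - 1 * a) <= eps / 12 * m).
{ eapply Rle_trans; [apply H1; lra |]. apply Rmult_le_compat; try lra.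
  - apply Rlt_le, Rmin_pos; lra.
  - apply Rabs_pos. }
assert (A1' : Rabs (exp a - 1 - 1 * a) <= Rabs a).
{ eapply Rle_trans; [apply H1; lra |]. rewrite <- (Rmult_1_l (Rabs a)) at 2.
  apply Rmult_le_compat_r; [apply Rabs_pos | lra]. }
assert (A2 : Rabs (cos b - 1 - 0 * b) <= eps / 12 * m).
{ eapply Rle_trans; [apply H2; lra |]. apply Rmult_le_compat_l; lra. }
assert (A3 : Rabs (sin b - 0 - 1 * b) <= eps / 12 * m).
{ eapply Rle_trans; [apply H3; lra |]. apply Rmult_le_compat_l; lra. }
assert (A4 : Rabs (exp a - 1) <= 2 * m).
{ replace (exp a - 1) with ((exp a - 1 - 1 * a) + a) by ring.
  eapply Rle_trans; [apply Rabs_triang | lra]. }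
assert (A5 : Rabs (exp a) <= 2).
{ replace (exp a) with ((exp a - 1) + 1) by ring.
  eapply Rle_trans; [apply Rabs_triang | rewrite Rabs_R1; lra]. }
assert (B1 : Rabs (exp a * cos b - 1 - a) <= eps / 2 * m).
{ replace (exp a * cos b - 1 - a)
    with (exp a * (cos b - 1 - 0 * b) + (exp a - 1 - 1 * a)) by ring.
  eapply Rle_trans; [apply Rabs_triang |]; rewrite Rabs_mult.
  assert (Rabs (exp a) * Rabs (cos b - 1 - 0 * b) <= 2 * (eps / 12 * m)).
  { apply Rmult_le_compat; try apply Rabs_pos; assumption. }
  assert (0 <= m) by apply Cmod_ge_0; nra. }
assert (B2 : Rabs (exp a * sin b - b) <= eps / 2 * m).
{ replace (exp a * sin b - b)
    with (exp a * (sin b - 0 - 1 * b) + (exp a - 1) * b) by ring.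
  eapply Rle_trans; [apply Rabs_triang |]; rewrite !Rabs_mult.
  assert (Rabs (exp a) * Rabs (sin b - 0 - 1 * b) <= 2 * (eps / 12 * m)).
  { apply Rmult_le_compat; try apply Rabs_pos; assumption. }
  assert (Rabs (exp a - 1) * Rabs b <= (2 * m) * (eps / 12)).
  { apply Rmult_le_compat; try apply Rabs_pos; lra. }
  assert (0 <= m) by apply Cmod_ge_0; nra. }
eapply Rle_trans; [apply Cmod_le_Rabs |].
unfold Cexp, Re, Im; simpl.
rewrite exp_0, cos_0, sin_0.
replace (exp a * cos b + - (1 * 1) + - (a * 1 - b * 0)) with (exp a * cos b - 1 - a) by ring.
replace (exp a * sin b + - (1 * 0) + - (a * 0 + b * 1)) with (exp a * sin b - b) by ring.
fold m; lra.
Qed.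

Lemma is_Cderive_exp (z : C) : is_Cderive Cexp z (Cexp z).
Proof.
apply is_Cderive_eps; intros eps Heps.
assert (Hpos : 0 < Cmod (Cexp z) + 1) by (pose proof (Cmod_ge_0 (Cexp z)); lra).
destruct (proj1 (is_Cderive_eps _ _ _) is_Cderive_exp_0 (eps / (Cmod (Cexp z) + 1)))
  as (delta & Hd & H); [apply Rdiv_lt_0_compat; lra |].
exists delta; split; [exact Hd |]; intros w Hw.
specialize (H (w - z)%C).
replace (w - z - 0)%C with (w - z)%C in H by ring.
specialize (H Hw).
assert (E0 : Cexp 0 = 1%C).
{ unfold Cexp; simpl; rewrite exp_0, cos_0, sin_0, !Rmult_1_l; reflexivity. }
rewrite E0 in H.
replace (Cexp w) with (Cexp z * Cexp (w - z))%C
  by (rewrite <- Cexp_plus; f_equal; ring).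
replace (Cexp z * Cexp (w - z) - Cexp z - (w - z) * Cexp z)%C
  with (Cexp z * (Cexp (w - z) - 1 - (w - z) * 1))%C by ring.
rewrite Cmod_mult.
apply Rle_trans with (Cmod (Cexp z) * (eps / (Cmod (Cexp z) + 1) * Cmod (w - z))).
{ apply Rmult_le_compat_l; [apply Cmod_ge_0 | exact H]. }
rewrite <- Rmult_assoc.
apply Rmult_le_compat_r; [apply Cmod_ge_0 |].
apply Rmult_le_reg_r with (Cmod (Cexp z) + 1); [exact Hpos |].
replace (Cmod (Cexp z) * (eps / (Cmod (Cexp z) + 1)) * (Cmod (Cexp z) + 1))
  with (Cmod (Cexp z) * eps) by (field; lra).
pose proof (Cmod_ge_0 (Cexp z)); nra.
Qed.

(** With f = u + i v, f dz has imaginary part v dx + u dy and real part u dx - v dy, in this order;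
    the shared coefficient [q] is in both cases one of the Cauchy-Riemann equations. *)
Lemma is_Cderive_closed_forms (f : C -> C) (x y : R) (l : C) :
  is_Cderive f (x, y) l ->
  closed_form_at (fun x y => Im (f (x, y))) (fun x y => Re (f (x, y))) x y /\
  closed_form_at (fun x y => Re (f (x, y))) (fun x y => - Im (f (x, y))) x y.
Proof.
intros H.
assert (K : forall eps, 0 < eps -> exists delta, 0 < delta /\
  forall x' y', Rabs (x' - x) < delta -> Rabs (y' - y) < delta ->
    Rabs (Re (f (x', y')) - (Re (f (x, y)) + Re l * (x' - x) - Im l * (y' - y)))
      <= eps * (Rabs (x' - x) + Rabs (y' - y)) /\
    Rabs (Im (f (x', y')) - (Im (f (x, y)) + Im l * (x' - x) + Re l * (y' - y)))
      <= eps * (Rabs (x' - x) + Rabs (y' - y))).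
{ intros eps Heps.
  destruct (proj1 (is_Cderive_eps _ _ _) H eps Heps) as (delta & Hd & H1).
  exists (delta / 2); split; [lra |]; intros x' y' Hx' Hy'.
  assert (M := Cmod_le_Rabs ((x', y') - (x, y))%C).
  unfold Re, Im in M; simpl in M; fold (x' - x) (y' - y) in M.
  specialize (H1 (x', y')).
  assert (H2 : Cmod (f (x', y') - f (x, y) - ((x', y') - (x, y)) * l)
          <= eps * (Rabs (x' - x) + Rabs (y' - y))).
  { eapply Rle_trans; [apply H1; lra |]; apply Rmult_le_compat_l; lra. }
  assert (A := re_le_Cmod (f (x', y') - f (x, y) - ((x', y') - (x, y)) * l)%C).
  assert (B := im_le_Cmod (f (x', y') - f (x, y) - ((x', y') - (x, y)) * l)%C).
  destruct (f (x', y')) as [u' v'], (f (x, y)) as [u v], l as [l1 l2].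
  unfold Re, Im in *; simpl in *.
  split; (eapply Rle_trans; [| exact H2]).
  - eapply Rle_trans; [| exact A]; apply Req_le; f_equal; ring.
  - eapply Rle_trans; [| exact B]; apply Req_le; f_equal; ring. }
split.
- exists (Im l), (Re l), (- Im l); intros eps Heps.
  destruct (K eps Heps) as (delta & Hd & H1).
  exists delta; split; [exact Hd |]; intros x' y' Hx' Hy'.
  destruct (H1 x' y' Hx' Hy') as [A B]; split.
  + exact B.
  + eapply Rle_trans; [| exact A]; apply Req_le; f_equal; ring.
- exists (Re l), (- Im l), (- Re l); intros eps Heps.
  destruct (K eps Heps) as (delta & Hd & H1).
  exists delta; split; [exact Hd |]; intros x' y' Hx' Hy'.
  destruct (H1 x' y' Hx' Hy') as [A B]; split.
  + eapply Rle_trans; [| exact A]; apply Req_le; f_equal; ring.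
  + eapply Rle_trans; [| exact B]; rewrite <- Rabs_Ropp; apply Req_le; f_equal; ring.
Qed.

(** * The kernel coth (w / 2) *)

(* [coth (w / 2)], of period [2 * PI * Ci]. *)
Definition half_coth (w : C) : C := ((Cexp w + 1) / (Cexp w - 1))%C.

Lemma cosh_gt_1 (a : R) : a <> 0 -> 1 < cosh a.
Proof.
intros Ha.
assert (H := exp_ineq1 a Ha); assert (H' := exp_ineq1 (- a) (Ropp_neq_0_compat a Ha)).
unfold cosh; lra.
Qed.

Lemma cosh_ge_1 (a : R) : 1 <= cosh a.
Proof.
destruct (Req_dec a 0) as [-> | Ha]; [rewrite cosh_0; lra | apply Rlt_le, cosh_gt_1, Ha].
Qed.

Lemma cos_lt_1 (b : R) : b <> 0 -> - (2 * PI) < b < 2 * PI -> cos b < 1.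
Proof.
intros Hb Hb'.
replace b with (2 * (b / 2)) by field; rewrite cos_2a_sin.
enough (sin (b / 2) <> 0) by nra.
destruct (Rtotal_order b 0) as [H | [H | H]]; [| contradiction |].
- assert (0 < sin (- (b / 2))) by (apply sin_gt_0; lra).
  rewrite sin_neg in *; lra.
- assert (0 < sin (b / 2)) by (apply sin_gt_0; lra); lra.
Qed.

Lemma cosh_minus_cos_pos (a b : R) :
  a <> 0 \/ (b <> 0 /\ - (2 * PI) < b < 2 * PI) -> 0 < cosh a - cos b.
Proof.
intros [Ha | [Hb Hb']].
- assert (H := cosh_gt_1 a Ha); destruct (COS_bound b); lra.
- assert (H := cos_lt_1 b Hb Hb'); assert (H' := cosh_ge_1 a); lra.
Qed.

(** For w = a + i b one has |e^w - 1|^2 = 2 e^a (cosh a - cos b), so positivity of [cosh a - cos b]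
    is the form in which poles are excluded throughout. Here e^w = 1 forces e^a = 1 by comparing
    moduli, and then cosh a = cos b = 1. *)
Lemma Cexp_neq_1 (a b : R) : 0 < cosh a - cos b -> (Cexp (a, b) - 1 <> 0)%C.
Proof.
intros H E.
unfold Cexp, Cminus, Cplus, Copp, RtoC in E; simpl in E; injection E as E1 E2.
assert (Ea := exp_pos a).
assert (Hab : exp a * exp (- a) = 1) by (rewrite <- exp_plus, Rplus_opp_r; apply exp_0).
assert (S : exp a ^ 2 = 1).
{ transitivity ((exp a * cos b) ^ 2 + (exp a * sin b) ^ 2).
  - assert (T := sin2_cos2 b); unfold Rsqr in T.
    transitivity (exp a ^ 2 * (sin b * sin b + cos b * cos b)); [rewrite T |]; ring.
  - replace (exp a * cos b) with 1 by lra; replace (exp a * sin b) with 0 by lra; ring. }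
assert (exp a = 1) by nra.
assert (exp (- a) = 1) by nra.
unfold cosh in H; nra.
Qed.

(** Checked without complex division, by multiplying the claimed value by e^w - 1 and comparing with
    e^w + 1. *)
Lemma half_coth_eq (a b : R) : 0 < cosh a - cos b ->
  half_coth (a, b) = (sinh a / (cosh a - cos b), - (sin b / (cosh a - cos b))).
Proof.
intros H.
assert (Hn := Cexp_neq_1 a b H).
pose (q := (sinh a / (cosh a - cos b), - (sin b / (cosh a - cos b))) : C).
fold q; unfold half_coth.
assert (E : (Cexp (a, b) + 1 = q * (Cexp (a, b) - 1))%C).
{ assert (Hab : exp a * exp (- a) = 1) by (rewrite <- exp_plus, Rplus_opp_r; apply exp_0).
  assert (T : sin b * sin b = 1 - cos b * cos b)
    by (assert (T := sin2_cos2 b); unfold Rsqr in T; lra).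
  assert (E1 : sinh a * (exp a * cos b - 1) + exp a * (sin b * sin b)
               = (exp a * cos b + 1) * (cosh a - cos b)).
  { assert (E : exp a * exp (- a) * cos b = 1 * cos b) by (rewrite Hab; reflexivity).
    rewrite T; unfold sinh, cosh; lra. }
  assert (E2 : sinh a * exp a - exp a * cos b + 1 = exp a * (cosh a - cos b)).
  { unfold sinh, cosh; lra. }
  unfold q, Cexp, Cminus, Cplus, Copp, Cmult, RtoC; simpl; f_equal.
  - apply Rmult_eq_reg_r with (cosh a - cos b); [| lra].
    rewrite <- E1; field; lra.
  - apply Rmult_eq_reg_r with (cosh a - cos b); [| lra].
    replace ((exp a * sin b + 0) * (cosh a - cos b))
      with (sin b * (exp a * (cosh a - cos b))) by ring.
    rewrite <- E2; field; lra. }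
unfold Cdiv; rewrite E, <- Cmult_assoc, Cinv_r, Cmult_1_r; [reflexivity | exact Hn].
Qed.

Lemma half_coth_conj (w : C) : half_coth (Cconj w) = Cconj (half_coth w).
Proof.
assert (HE : Cexp (Cconj w) = Cconj (Cexp w)).
{ destruct w as [a b]; unfold Cexp, Cconj; simpl; rewrite cos_neg, sin_neg; f_equal; ring. }
unfold half_coth; rewrite HE.
destruct (Cexp w) as [a b].
unfold Cdiv, Cinv, Cmult, Cminus, Cplus, Copp, Cconj, RtoC; simpl.
replace ((- b + - 0) * ((- b + - 0) * 1)) with ((b + - 0) * ((b + - 0) * 1)) by ring.
f_equal; unfold Rdiv; ring.
Qed.

Lemma ex_Cderive_half_coth (k : R) (z0 z : C) :
  (Cexp (k * (z - z0)) - 1 <> 0)%C ->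
  exists l, is_Cderive (fun w => half_coth (k * (w - z0))) z l.
Proof.
intros H.
assert (DE : is_Cderive (fun w => Cexp (k * (w - z0))) z (k * Cexp (k * (z - z0)))%C).
{ apply (is_Cderive_comp Cexp (fun w => (k * (w - z0))%C));
    [apply is_Cderive_exp | apply is_Cderive_affine]. }
eexists; unfold half_coth, Cdiv.
apply (is_Cderive_mult (fun w => Cexp (k * (w - z0)) + 1)%C
  (fun w => / (Cexp (k * (w - z0)) - 1))%C).
- apply is_Cderive_plus; [exact DE | apply is_Cderive_const].
- apply (is_Cderive_comp Cinv (fun w => Cexp (k * (w - z0)) - 1)%C).
  + apply is_Cderive_inv, H.
  + apply is_Cderive_minus; [exact DE | apply is_Cderive_const].
Qed.

(** [A] is separate from [F z0] because the reflected half uses the conjugate value at the conjugate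
    point with the same [F]. *)
Definition coth_quotient (F : C -> C) (k : R) (A z0 z : C) : C :=
  ((F z - A) * half_coth (k * (z - z0)))%C.

Lemma ex_Cderive_coth_quotient (F : C -> C) (k : R) (A z0 z l : C) :
  is_Cderive F z l -> (Cexp (k * (z - z0)) - 1 <> 0)%C ->
  exists m, is_Cderive (coth_quotient F k A z0) z m.
Proof.
intros HF H; destruct (ex_Cderive_half_coth k z0 z H) as [m Hm].
eexists; unfold coth_quotient.
apply (is_Cderive_mult (fun w => F w - A)%C (fun w => half_coth (k * (w - z0)))).
- apply is_Cderive_minus; [exact HF | apply is_Cderive_const].
- exact Hm.
Qed.

(** The numerator [F z - F z0] is of order |z - z0|, while e^(k (z - z0)) - 1 is at least k / 2
    times |z - z0| because its derivative at [z0] is [k]; the simple pole is cancelled. *)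
Lemma coth_quotient_bounded (F : C -> C) (k : R) (z0 l : C) :
  0 < k -> is_Cderive F z0 l ->
  exists delta M, 0 < delta /\ forall z, Cmod (z - z0) < delta ->
    Cmod (coth_quotient F k (F z0) z0 z) <= M.
Proof.
intros Hk HF.
assert (E0 : Cexp (k * (z0 - z0)) = 1%C).
{ replace (k * (z0 - z0))%C with (RtoC 0) by ring.
  unfold Cexp; simpl; rewrite exp_0, cos_0, sin_0, !Rmult_1_l; reflexivity. }
assert (DE : is_Cderive (fun w => Cexp (k * (w - z0))) z0 (k * Cexp (k * (z0 - z0)))%C).
{ apply (is_Cderive_comp Cexp (fun w => (k * (w - z0))%C));
    [apply is_Cderive_exp | apply is_Cderive_affine]. }
destruct (is_Cderive_lipschitz _ _ _ HF) as (d1 & Hd1 & H1).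
destruct (is_Cderive_bounded _ _ _ DE) as (d2 & N & Hd2 & H2).
destruct (proj1 (is_Cderive_eps _ _ _) DE (k / 2)) as (d3 & Hd3 & H3); [lra |].
rewrite E0 in H3.
exists (Rmin d1 (Rmin d2 d3)), ((Cmod l + 1) * ((N + 1) * (2 / k))); split.
{ repeat apply Rmin_pos; assumption. }
intros z Hz.
assert (M1 := Rmin_l d1 (Rmin d2 d3)); assert (M2 := Rmin_r d1 (Rmin d2 d3)).
assert (M3 := Rmin_l d2 d3); assert (M4 := Rmin_r d2 d3).
specialize (H1 z); specialize (H2 z); specialize (H3 z).
assert (HN : 0 <= N).
{ eapply Rle_trans; [apply Cmod_ge_0 | apply H2; lra]. }
assert (HL := Cmod_ge_0 l).
unfold coth_quotient, half_coth.
(* At [z0] itself the factor [F z0 - F z0] gives 0, whatever the inverse of 0 is. *)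
destruct (Ceq_dec z z0) as [-> | Hne].
{ replace (F z0 - F z0)%C with (RtoC 0) by ring.
  rewrite Cmult_0_l, Cmod_0.
  apply Rmult_le_pos; [lra | apply Rmult_le_pos; [lra | apply Rlt_le, Rdiv_lt_0_compat; lra]]. }
assert (Hd : 0 < Cmod (z - z0)).
{ apply Cmod_gt_0; intros E; apply Hne.
  replace z with ((z - z0) + z0)%C by ring; rewrite E; ring. }
set (e := Cexp (k * (z - z0))) in *.
assert (Hlow : k / 2 * Cmod (z - z0) <= Cmod (e - 1)).
{ assert (T := Cmod_triangle (e - 1) (- (e - 1 - (z - z0) * (k * 1)))).
  replace (e - 1 + - (e - 1 - (z - z0) * (k * 1)))%C with (k * (z - z0))%C in T by ring.
  rewrite Cmod_opp, Cmod_mult, Cmod_R, (Rabs_right k) in T by lra.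
  assert (H3' := H3 ltac:(lra)); lra. }
assert (Hpos : 0 < k / 2 * Cmod (z - z0)) by (apply Rmult_lt_0_compat; lra).
assert (He : (e - 1 <> 0)%C) by (apply Cmod_gt_0; lra).
unfold Cdiv; rewrite !Cmod_mult, Cmod_inv by exact He.
apply Rle_trans with
  (((Cmod l + 1) * Cmod (z - z0)) * ((N + 1) * / (k / 2 * Cmod (z - z0)))).
- apply Rmult_le_compat; [apply Cmod_ge_0 | | apply H1; lra |].
  { apply Rmult_le_pos; [apply Cmod_ge_0 | apply Rlt_le, Rinv_0_lt_compat; lra]. }
  apply Rmult_le_compat; [apply Cmod_ge_0 | apply Rlt_le, Rinv_0_lt_compat; lra | |].
  + eapply Rle_trans; [apply Cmod_triangle |]; rewrite Cmod_1.
    apply Rplus_le_compat_r, H2; lra.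
  + apply Rinv_le_contravar; assumption.
- apply Req_le; field; lra.
Qed.

(** * The contour integral over a rectangle *)

Lemma scale_minus_pair (k x y x0 y0 : R) :
  (k * ((x, y) - (x0, y0)))%C = (k * (x - x0), k * (y - y0)).
Proof. unfold Cmult, Cminus, Cplus, Copp, RtoC; simpl; f_equal; ring. Qed.

Lemma RtoC_eq_pair (x y : R) : (RtoC x + Ci * RtoC y)%C = (x, y).
Proof. unfold Cplus, Cmult, RtoC, Ci; simpl; f_equal; ring. Qed.

(** [half_coth (a, b)] has real part [coth_re a b] and imaginary part minus [coth_im a b]. *)
Definition coth_re (a b : R) : R := sinh a / (cosh a - cos b).
Definition coth_im (a b : R) : R := sin b / (cosh a - cos b).

Section Contour.

Variables (h : R) (F : C -> C) (x0 y0 : R).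
Hypothesis h_pos : 0 < h.
Hypothesis F_deriv : forall x y, 0 <= y <= h -> exists l, is_Cderive F (x, y) l.
Hypothesis F_real : forall x, Im (F (x, 0)) = 0.
Hypothesis y0_range : 0 <= y0 < h.

Let k : R := PI / h.
Let z0 : C := (x0, y0).
Let A0 : C := F z0.
Let u (x y : R) : R := Re (F (x, y)).
Let v (x y : R) : R := Im (F (x, y)).
(* By Schwarz reflection, [F (Cconj z) = Cconj (F z)] continues [F] to the strip
   [- h <= Im z <= h]; conjugating the contribution of the reflected half turns
   its integrand into [G2] on the original half. *)
Let G1 : C -> C := coth_quotient F k A0 z0.
Let G2 : C -> C := coth_quotient F k (Cconj A0) (Cconj z0).

Lemma strip_scale_pos : 0 < k.
Proof. apply Rdiv_lt_0_compat; [apply PI_RGT_0 | exact h_pos]. Qed.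

Lemma strip_scale_lt (s : R) : - (2 * h) < s < 2 * h -> - (2 * PI) < k * s < 2 * PI.
Proof.
intros Hs; assert (Hk := strip_scale_pos).
assert (E : 2 * PI = k * (2 * h)) by (unfold k; field; lra).
rewrite E; nra.
Qed.

(** Poles recur vertically with period 2 h, so [s = 0] is the only one in this range. Both
    [s = y - y0] and [s = y + y0] fall in it, the latter because [y0 < h]. *)
Lemma cosh_minus_cos_strip_pos (x s : R) :
  - (2 * h) < s < 2 * h -> x <> x0 \/ s <> 0 ->
  0 < cosh (k * (x - x0)) - cos (k * s).
Proof.
intros Hs H; assert (Hk := strip_scale_pos); apply cosh_minus_cos_pos.
destruct H as [H | H]; [left | right; split].
- apply Rmult_integral_contrapositive; lra.
- apply Rmult_integral_contrapositive; lra.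
- apply strip_scale_lt, Hs.
Qed.

(** The pole of [G2] is the conjugate of [z0]; it meets the upper half only for [y0 = 0], where it
    coincides with [z0]. One exceptional point thus serves both functions. *)
Lemma kernel_pair_deriv (x y : R) :
  0 <= y <= h -> x <> x0 \/ y <> y0 ->
  (exists m, is_Cderive G1 (x, y) m) /\ (exists m, is_Cderive G2 (x, y) m).
Proof.
intros Hy H; destruct (F_deriv x y Hy) as [l Hl].
split; apply ex_Cderive_coth_quotient with l; try exact Hl; unfold z0, Cconj; simpl;
  rewrite scale_minus_pair; apply Cexp_neq_1, cosh_minus_cos_strip_pos; lra.
Qed.

Lemma kernel_pair_bounded :
  exists delta M, 0 < delta /\ forall x y, Rabs (x - x0) <= delta -> Rabs (y - y0) <= delta ->
    Cmod (G1 (x, y)) <= M /\ Cmod (G2 (x, y)) <= M.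
Proof.
assert (Hk := strip_scale_pos).
destruct (F_deriv x0 y0) as [l Hl]; [lra |].
destruct (coth_quotient_bounded F k z0 l Hk Hl) as (d1 & M1 & Hd1 & H1).
assert (exists d2 M2, 0 < d2 /\ forall z, Cmod (z - z0) < d2 -> Cmod (G2 z) <= M2)
  as (d2 & M2 & Hd2 & H2).
(* For [y0 > 0] the function [G2] is differentiable at [z0]; for [y0 = 0] the value [F z0] is real
   and [G2] equals [G1]. *)
{ destruct (Rle_lt_or_eq_dec 0 y0) as [Hy0 | Hy0]; [lra | |].
  - assert (Hdz : exists m, is_Cderive G2 z0 m).
    { apply ex_Cderive_coth_quotient with l; [exact Hl |].
      unfold z0, Cconj; simpl; rewrite scale_minus_pair.
      apply Cexp_neq_1, cosh_minus_cos_strip_pos; lra. }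
    destruct Hdz as [m Hm]; exact (is_Cderive_bounded _ _ _ Hm).
  - exists d1, M1; split; [exact Hd1 |].
    assert (E1 : Cconj z0 = z0) by (unfold z0, Cconj; simpl; rewrite <- Hy0, Ropp_0; reflexivity).
    assert (E2 : Cconj A0 = A0).
    { unfold A0, z0; rewrite <- Hy0; specialize (F_real x0).
      destruct (F (x0, 0)) as [p q]; unfold Im in F_real; simpl in F_real.
      rewrite F_real; unfold Cconj; simpl; rewrite Ropp_0; reflexivity. }
    unfold G2; rewrite E1, E2; exact H1. }
exists (Rmin d1 d2 / 3), (Rmax M1 M2).
assert (L1 := Rmin_l d1 d2); assert (L2 := Rmin_r d1 d2).
assert (Hm : 0 < Rmin d1 d2) by (apply Rmin_pos; assumption).
split; [lra |]; intros x y Hx Hy.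
assert (Hz : Cmod ((x, y) - z0) < Rmin d1 d2).
{ eapply Rle_lt_trans; [apply Cmod_le_Rabs |].
  unfold z0, Re, Im; simpl; fold (x - x0) (y - y0); lra. }
split.
- eapply Rle_trans; [apply H1; lra | apply Rmax_l].
- eapply Rle_trans; [apply H2; lra | apply Rmax_r].
Qed.

(** This replaces Schwarz reflection: [Im (G1 + G2)] and [Re (G1 - G2)] vanish on the real axis,
    because [F] is real there. *)
Lemma kernel_pair_bottom (t : R) : G2 (t, 0) = Cconj (G1 (t, 0)).
Proof.
assert (HC : forall z w, Cconj (z * w) = (Cconj z * Cconj w)%C).
{ intros [a b] [c d]; unfold Cconj, Cmult; simpl; f_equal; ring. }
unfold G2, G1, coth_quotient; rewrite HC, <- half_coth_conj.
f_equal.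
- specialize (F_real t); destruct (F (t, 0)) as [p q], A0 as [r s].
  unfold Im in F_real; simpl in F_real; subst q.
  unfold Cconj, Cminus, Cplus, Copp; simpl; f_equal; ring.
- f_equal; unfold z0, Cconj, Cmult, Cminus, Cplus, Copp, RtoC; simpl; f_equal; ring.
Qed.

(** Conjugating the data changes the signs of [y0] and [v x0 y0], hence the plus signs in [G2]. *)
Lemma kernel_pair_value (x y : R) :
  0 <= y <= h -> x <> x0 \/ y <> y0 ->
  let a := k * (x - x0) in
  let b1 := k * (y - y0) in
  let b2 := k * (y + y0) in
  Re (G1 (x, y)) = (u x y - u x0 y0) * coth_re a b1 + (v x y - v x0 y0) * coth_im a b1 /\
  Im (G1 (x, y)) = (v x y - v x0 y0) * coth_re a b1 - (u x y - u x0 y0) * coth_im a b1 /\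
  Re (G2 (x, y)) = (u x y - u x0 y0) * coth_re a b2 + (v x y + v x0 y0) * coth_im a b2 /\
  Im (G2 (x, y)) = (v x y + v x0 y0) * coth_re a b2 - (u x y - u x0 y0) * coth_im a b2.
Proof.
intros Hy H a b1 b2.
unfold G1, G2, coth_quotient.
change (Cconj z0) with ((x0, - y0) : C); unfold z0; rewrite !scale_minus_pair.
replace (y - - y0) with (y + y0) by ring; fold a b1 b2.
rewrite !half_coth_eq by (apply cosh_minus_cos_strip_pos; lra).
fold (coth_re a b1) (coth_im a b1) (coth_re a b2) (coth_im a b2).
unfold u, v, A0, z0; destruct (F (x, y)) as [p q], (F (x0, y0)) as [r s].
unfold Re, Im, Cmult, Cminus, Cplus, Copp; simpl; repeat split; ring.
Qed.

(** At height [h] the two angles are PI - k y0 and PI + k y0: equal cosines, opposite sines. The two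
    values of [coth_re] agree and those of [coth_im] are opposite, so [u] and the value at [z0]
    cancel and only the boundary values of [v] remain. *)
Lemma kernel_pair_top (t : R) :
  Im (G1 (t, h) + G2 (t, h)) =
    2 * (v t h * (sinh (k * (t - x0)) / (cosh (k * (t - x0)) + cos (k * y0)))) /\
  Re (G1 (t, h) - G2 (t, h)) =
    2 * (v t h * (sin (k * y0) / (cosh (k * (t - x0)) + cos (k * y0)))).
Proof.
destruct (kernel_pair_value t h) as (R1 & I1 & R2 & I2); [lra | right; lra |].
assert (E1 : k * (h - y0) = PI - k * y0) by (unfold k; field; lra).
assert (E2 : k * (h + y0) = k * y0 + PI) by (unfold k; field; lra).
assert (P := cosh_minus_cos_strip_pos t (h - y0) ltac:(lra) ltac:(right; lra)).
rewrite E1 in *; rewrite E2 in *; unfold coth_re, coth_im in *.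
rewrite neg_cos, neg_sin in *.
assert (Ec : cos (PI - k * y0) = - cos (k * y0)) by apply Rtrigo_facts.cos_pi_minus.
assert (Es : sin (PI - k * y0) = sin (k * y0)) by apply Rtrigo_facts.sin_pi_minus.
rewrite Ec, Es in *.
split.
- transitivity (Im (G1 (t, h)) + Im (G2 (t, h))); [reflexivity |].
  rewrite I1, I2; field; lra.
- transitivity (Re (G1 (t, h)) - Re (G2 (t, h))); [reflexivity |].
  rewrite R1, R2; field; lra.
Qed.

(** Goursat is applied to the imaginary part of (G1 + G2) dz and to the real part of (G1 - G2) dz,
    the two real forms whose dx coefficient vanishes on the bottom side; the top side is left
    against the vertical ones. *)
Theorem contour_identities (a b : R) : a < x0 < b ->
  let side_re X := RInt (fun y => Re (G1 (X, y) + G2 (X, y))) 0 h in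
  let side_im X := RInt (fun y => - Im (G1 (X, y) - G2 (X, y))) 0 h in
  RInt (fun t => Im (G1 (t, h) + G2 (t, h))) a b = side_re b - side_re a /\
  RInt (fun t => Re (G1 (t, h) - G2 (t, h))) a b = side_im b - side_im a.
Proof.
intros Hab side_re side_im.
destruct kernel_pair_bounded as (delta & M & Hd & HM).
assert (HZ : forall f, (forall t, f t = 0) -> RInt f a b = 0).
{ intros f Hf; rewrite (RInt_ext f (fun _ => 0)) by (intros; apply Hf).
  rewrite RInt_const_R; apply Rmult_0_l. }
assert (HB : forall x y, Rabs (x - x0) <= delta -> Rabs (y - y0) <= delta ->
  Cmod (G1 (x, y) + G2 (x, y)) <= 2 * M /\ Cmod (G1 (x, y) - G2 (x, y)) <= 2 * M).
{ intros x y Hx Hy; destruct (HM x y Hx Hy) as [B1 B2]; split.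
  - eapply Rle_trans; [apply Cmod_triangle | lra].
  - eapply Rle_trans; [apply Cmod_triangle | rewrite Cmod_opp; lra]. }
split.
- pose (P := fun x y => Im (G1 (x, y) + G2 (x, y))).
  pose (Q := fun x y => Re (G1 (x, y) + G2 (x, y))).
  assert (Hbot : forall t, P t 0 = 0).
  { intros t; unfold P; rewrite kernel_pair_bottom.
    destruct (G1 (t, 0)) as [p q]; unfold Im; simpl; ring. }
  assert (E : rect_int P Q a b 0 h = 0).
  { apply goursat_punctured with x0 y0 (2 * M) delta; try assumption.
    - intros x y Hx Hy H; destruct (kernel_pair_deriv x y Hy H) as [[m1 H1] [m2 H2]].
      apply (is_Cderive_closed_forms (fun z => G1 z + G2 z)%C x y (m1 + m2)%C).
      apply is_Cderive_plus; assumption.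
    - intros x y Hx Hy; destruct (HB x y Hx Hy) as [B _]; split.
      + eapply Rle_trans; [apply im_le_Cmod | exact B].
      + eapply Rle_trans; [apply re_le_Cmod | exact B]. }
  unfold rect_int in E; rewrite (HZ _ Hbot) in E.
  unfold side_re; fold (Q b) (Q a); change (RInt (fun t => P t h) a b = RInt (fun s => Q b s) 0 h - RInt (fun s => Q a s) 0 h); lra.
- pose (P := fun x y => Re (G1 (x, y) - G2 (x, y))).
  pose (Q := fun x y => - Im (G1 (x, y) - G2 (x, y))).
  assert (Hbot : forall t, P t 0 = 0).
  { intros t; unfold P; rewrite kernel_pair_bottom.
    destruct (G1 (t, 0)) as [p q]; unfold Re; simpl; ring. }
  assert (E : rect_int P Q a b 0 h = 0).
  { apply goursat_punctured with x0 y0 (2 * M) delta; try assumption.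
    - intros x y Hx Hy H; destruct (kernel_pair_deriv x y Hy H) as [[m1 H1] [m2 H2]].
      apply (is_Cderive_closed_forms (fun z => G1 z - G2 z)%C x y (m1 - m2)%C).
      apply is_Cderive_minus; assumption.
    - intros x y Hx Hy; destruct (HB x y Hx Hy) as [_ B]; split.
      + eapply Rle_trans; [apply re_le_Cmod | exact B].
      + unfold Q; rewrite Rabs_Ropp; eapply Rle_trans; [apply im_le_Cmod | exact B]. }
  unfold rect_int in E; rewrite (HZ _ Hbot) in E.
  change (RInt (fun t => P t h) a b = RInt (fun s => Q b s) 0 h - RInt (fun s => Q a s) 0 h); lra.
Qed.

End Contour.

(** * Contributions of the vertical sides *)

(** Only the primitive of [f] has a known size: [mu * eta] is the boundary term at [h], and
    [h * mu * eta'] bounds the integral against [w']. *)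
Lemma RInt_by_parts_bound (f w w' : R -> R) (h mu eta eta' : R) :
  0 <= h ->
  (forall y, 0 <= y <= h -> continuous f y) ->
  (forall y, 0 <= y <= h -> is_derive w y (w' y)) ->
  (forall y, 0 <= y <= h -> continuous w' y) ->
  (forall y, 0 <= y <= h -> Rabs (RInt f 0 y) <= mu) ->
  (forall y, 0 <= y <= h -> Rabs (w y) <= eta /\ Rabs (w' y) <= eta') ->
  Rabs (RInt (fun y => f y * w y) 0 h) <= mu * (eta + h * eta').
Proof.
intros Hh Hf Hw Hw' Hmu Heta.
(* Differentiating the primitive of [f] at [0] and [h] needs a continuous extension. *)
pose (f1 := extension_C0 f 0 h).
assert (Hf1 : forall y, continuous f1 y).
{ apply extension_C0_continuous; simpl; [exact Hh | intros; apply Hf; split; assumption]. }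
assert (Ef : forall y, 0 <= y <= h -> f1 y = f y).
{ intros y Hy; apply extension_C0_ext; simpl; apply Hy. }
assert (EM : forall y, 0 <= y <= h -> RInt f1 0 y = RInt f 0 y).
{ intros y Hy; apply RInt_ext; intros x Hx; rewrite Rmin_left, Rmax_right in Hx by lra.
  apply Ef; lra. }
assert (DM : forall y, is_derive (fun y => RInt f1 0 y) y (f1 y)).
{ intros y; apply (is_derive_RInt f1 (fun y => RInt f1 0 y) 0 y); [| apply Hf1].
  apply filter_forall; intros z; apply (RInt_correct (V := R_CompleteNormedModule)).
  apply (ex_RInt_continuous (V := R_CompleteNormedModule)); intros; apply Hf1. }
assert (HMc : forall y, continuous (fun y => RInt f1 0 y) y).
{ intros y; apply (ex_derive_continuous (V := R_NormedModule)); eexists; apply DM. }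
assert (Cw : forall y, 0 <= y <= h -> continuous w y).
{ intros y Hy; apply (ex_derive_continuous (V := R_NormedModule)); eexists; apply Hw, Hy. }
assert (I1 : ex_RInt (fun y => f1 y * w y) 0 h).
{ apply ex_RInt_of_continuous; [exact Hh |]; intros y Hy.
  apply (continuous_mult f1 w); auto. }
assert (I2 : ex_RInt (fun y => RInt f1 0 y * w' y) 0 h).
{ apply ex_RInt_of_continuous; [exact Hh |]; intros y Hy.
  apply (continuous_mult (fun y => RInt f1 0 y) w'); auto. }
assert (P : RInt (fun y => f1 y * w y) 0 h + RInt (fun y => RInt f1 0 y * w' y) 0 h
            = RInt f1 0 h * w h).
{ rewrite <- RInt_plus_R by assumption.
  apply is_RInt_unique.
  replace (RInt f1 0 h * w h)
    with (minus (scal (RInt f1 0 h) (w h)) (scal (RInt f1 0 0) (w 0))).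
  2: { rewrite RInt_point; unfold minus, scal, plus, opp, zero; simpl; unfold mult; simpl; ring. }
  apply (is_RInt_scal_derive (V := R_CompleteNormedModule) (fun y => RInt f1 0 y) w f1 w');
    intros y Hy; rewrite Rmin_left, Rmax_right in Hy by lra; auto. }
assert (B1 : Rabs (RInt (fun y => RInt f1 0 y * w' y) 0 h) <= (h - 0) * (mu * eta')).
{ apply abs_RInt_le_const; [exact Hh | exact I2 |]; intros y Hy.
  rewrite Rabs_mult, EM by exact Hy.
  apply Rmult_le_compat; try apply Rabs_pos; [apply Hmu | apply Heta]; exact Hy. }
assert (B2 : Rabs (RInt f1 0 h * w h) <= mu * eta).
{ rewrite Rabs_mult, EM by lra.
  apply Rmult_le_compat; try apply Rabs_pos; [apply Hmu | apply Heta]; lra. }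
rewrite (RInt_ext (fun y => f y * w y) (fun y => f1 y * w y)).
2: { intros y Hy; rewrite Rmin_left, Rmax_right in Hy by lra; rewrite Ef by lra; reflexivity. }
replace (RInt (fun y => f1 y * w y) 0 h)
  with (RInt f1 0 h * w h - RInt (fun y => RInt f1 0 y * w' y) 0 h) by lra.
apply Rabs_le_between in B1, B2; apply Rabs_le; lra.
Qed.

(** [u] is known through its primitive, so its weight must be differentiable; [v] is bounded
    pointwise and its weights need only be small. The constant [U0] adds at most [h * Rabs U0] to
    the primitive. *)
Lemma weighted_side_bound (h U0 V0 mu nu eta eta' : R) (u v w w' r1 r2 : R -> R) :
  0 <= h ->
  (forall y, 0 <= y <= h -> continuous u y /\ continuous v y) ->
  (forall y, 0 <= y <= h -> is_derive w y (w' y)) ->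
  (forall y, 0 <= y <= h -> continuous w' y /\ continuous r1 y /\ continuous r2 y) ->
  (forall y, 0 <= y <= h -> Rabs (RInt u 0 y) <= mu /\ Rabs (v y) <= nu) ->
  (forall y, 0 <= y <= h ->
     Rabs (w y) <= eta /\ Rabs (w' y) <= eta' /\ Rabs (r1 y) <= eta /\ Rabs (r2 y) <= eta) ->
  ex_RInt (fun y => (u y - U0) * w y + ((v y - V0) * r1 y + (v y + V0) * r2 y)) 0 h /\
  Rabs (RInt (fun y => (u y - U0) * w y + ((v y - V0) * r1 y + (v y + V0) * r2 y)) 0 h)
    <= (mu + h * Rabs U0) * (eta + h * eta') + 2 * h * (nu + Rabs V0) * eta.
Proof.
intros Hh Huv Hw Hc Hb Heta.
assert (Cw : forall y, 0 <= y <= h -> continuous w y).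
{ intros y Hy; apply (ex_derive_continuous (V := R_NormedModule)); eexists; apply Hw, Hy. }
assert (Cu : forall y, 0 <= y <= h -> continuous (fun y => u y - U0) y).
{ intros y Hy; apply (continuous_minus u (fun _ => U0)); [apply Huv, Hy | apply continuous_const]. }
assert (I1 : ex_RInt (fun y => (u y - U0) * w y) 0 h).
{ apply ex_RInt_of_continuous; [exact Hh |]; intros y Hy.
  apply (continuous_mult (fun y => u y - U0) w); auto. }
assert (I2 : ex_RInt (fun y => (v y - V0) * r1 y + (v y + V0) * r2 y) 0 h).
{ apply ex_RInt_of_continuous; [exact Hh |]; intros y Hy.
  destruct (Hc y Hy) as (_ & C1 & C2); destruct (Huv y Hy) as [_ Cv].
  apply (continuous_plus (fun y => (v y - V0) * r1 y) (fun y => (v y + V0) * r2 y)).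
  - apply (continuous_mult (fun y => v y - V0) r1); [| exact C1].
    apply (continuous_minus v (fun _ => V0)); [exact Cv | apply continuous_const].
  - apply (continuous_mult (fun y => v y + V0) r2); [| exact C2].
    apply (continuous_plus v (fun _ => V0)); [exact Cv | apply continuous_const]. }
split; [exact (ex_RInt_plus _ _ _ _ I1 I2) |].
rewrite (RInt_plus_R _ _ _ _ I1 I2).
eapply Rle_trans; [apply Rabs_triang |]; apply Rplus_le_compat.
- apply RInt_by_parts_bound with w'; try assumption.
  + intros y Hy; apply Hc, Hy.
  + intros y Hy.
    assert (Iu : ex_RInt u 0 y).
    { apply ex_RInt_of_continuous; [lra |]; intros t Ht; apply Huv; lra. }
    replace (RInt (fun y => u y - U0) 0 y) with (RInt u 0 y - y * U0).
    * assert (B := proj1 (Hb y Hy)).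
      assert (Rabs (y * U0) <= h * Rabs U0).
      { rewrite Rabs_mult, (Rabs_right y) by lra.
        apply Rmult_le_compat_r; [apply Rabs_pos | lra]. }
      eapply Rle_trans; [apply Rabs_triang | rewrite Rabs_Ropp; lra].
    * rewrite (RInt_minus_R u (fun _ => U0)), RInt_const_R
        by (assumption || apply ex_RInt_const); ring.
  + intros y Hy; destruct (Heta y Hy) as (E1 & E2 & _); split; assumption.
- replace (2 * h * (nu + Rabs V0) * eta) with ((h - 0) * (2 * ((nu + Rabs V0) * eta))) by ring.
  apply abs_RInt_le_const; [exact Hh | exact I2 |]; intros y Hy.
  destruct (Heta y Hy) as (_ & _ & E1 & E2); destruct (Hb y Hy) as [_ Bv].
  assert (Rabs (v y - V0) <= nu + Rabs V0).
  { eapply Rle_trans; [apply Rabs_triang | rewrite Rabs_Ropp; lra]. }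
  assert (Rabs (v y + V0) <= nu + Rabs V0).
  { eapply Rle_trans; [apply Rabs_triang | lra]. }
  assert (Rabs ((v y - V0) * r1 y) <= (nu + Rabs V0) * eta).
  { rewrite Rabs_mult; apply Rmult_le_compat; auto using Rabs_pos. }
  assert (Rabs ((v y + V0) * r2 y) <= (nu + Rabs V0) * eta).
  { rewrite Rabs_mult; apply Rmult_le_compat; auto using Rabs_pos. }
  eapply Rle_trans; [apply Rabs_triang | lra].
Qed.

(** * Exponential bounds for the kernel and its derivative *)

Definition coth_re' (a b : R) : R := - (sinh a * sin b) / (cosh a - cos b) ^ 2.
Definition coth_im' (a b : R) : R := (cosh a * cos b - 1) / (cosh a - cos b) ^ 2.

Lemma is_derive_coth_re (a b : R) :
  a <> 0 -> is_derive (coth_re a) b (coth_re' a b).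
Proof.
intros Ha; assert (P := cosh_minus_cos_pos a b (or_introl Ha)).
unfold coth_re, coth_re'; auto_derive; [lra | field; lra].
Qed.

Lemma is_derive_coth_im (a b : R) :
  a <> 0 -> is_derive (coth_im a) b (coth_im' a b).
Proof.
intros Ha; assert (P := cosh_minus_cos_pos a b (or_introl Ha)).
assert (T : sin b * sin b = 1 - cos b * cos b)
  by (assert (T := sin2_cos2 b); unfold Rsqr in T; lra).
unfold coth_im, coth_im'; auto_derive; [lra |].
field_simplify_eq; [| lra].
replace (sin b ^ 2) with (1 - cos b * cos b) by (rewrite <- T; ring); ring.
Qed.

Lemma continuous_coth_deriv (a b : R) :
  a <> 0 -> continuous (coth_re' a) b /\ continuous (coth_im' a) b.
Proof.
intros Ha; assert (P := cosh_minus_cos_pos a b (or_introl Ha)).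
split; apply (ex_derive_continuous (V := R_NormedModule)); unfold coth_re', coth_im';
  auto_derive; apply Rmult_integral_contrapositive; lra.
Qed.

(** For a >= 3 one has e^a > 4, so the denominator D = cosh a - cos b is at least e^a / 4 and 1 / D
    <= 4 e^(-a). The numerators over D are at most 2 and those over D^2 at most 5 D, whence 20. *)
Lemma coth_tail_bounds (a b : R) : 3 <= a ->
  Rabs (coth_re a b - 1) <= 20 * exp (- a) /\ Rabs (coth_im a b) <= 20 * exp (- a) /\
  Rabs (coth_re' a b) <= 20 * exp (- a) /\ Rabs (coth_im' a b) <= 20 * exp (- a).
Proof.
intros Ha.
assert (E := exp_ineq1 a ltac:(lra)).
assert (Hab : exp a * exp (- a) = 1) by (rewrite <- exp_plus, Rplus_opp_r; apply exp_0).
assert (Ei := exp_pos (- a)).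
assert (Ei1 : exp (- a) <= 1 / 4) by nra.
destruct (COS_bound b) as [C1 C2]; destruct (SIN_bound b) as [S1 S2].
set (D := cosh a - cos b).
assert (HD : exp a / 4 <= D) by (unfold D, cosh; lra).
assert (HD0 : 0 < D) by lra.
assert (Hinv : / D <= 4 * exp (- a)).
{ apply Rmult_le_reg_l with D; [exact HD0 |]; rewrite Rinv_r by lra; nra. }
assert (Hinv0 : 0 < / D) by (apply Rinv_0_lt_compat, HD0).
assert (K : forall n m, Rabs n <= m -> Rabs (n / D) <= m * (4 * exp (- a))).
{ intros n m Hn; unfold Rdiv; rewrite Rabs_mult, (Rabs_right (/ D)) by lra.
  apply Rmult_le_compat; try lra; apply Rabs_pos. }
assert (K2 : forall n m, Rabs n <= m * D -> Rabs (n / D ^ 2) <= m * (4 * exp (- a))).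
{ intros n m Hn; replace (n / D ^ 2) with (n / D / D) by (field; lra).
  apply K; unfold Rdiv; rewrite Rabs_mult, (Rabs_right (/ D)) by lra.
  apply Rmult_le_reg_r with D; [exact HD0 |].
  rewrite Rmult_assoc, Rinv_l by lra; lra. }
repeat split.
- replace (coth_re a b - 1) with ((- exp (- a) + cos b) / D).
  + eapply Rle_trans; [apply (K _ 2); apply Rabs_le; lra | lra].
  + unfold coth_re; fold D; replace (sinh a) with (D + (- exp (- a) + cos b))
      by (unfold D, sinh, cosh; field); field; lra.
- unfold coth_im; fold D; eapply Rle_trans; [apply (K _ 1); apply Rabs_le; lra | lra].
- unfold coth_re'; fold D; eapply Rle_trans; [apply (K2 _ 2) | lra].
  rewrite Rabs_Ropp, Rabs_mult, (Rabs_right (sinh a)) by (unfold sinh; lra).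
  assert (Rabs (sin b) <= 1) by (apply Rabs_le; lra).
  assert (sinh a <= 2 * D) by (unfold sinh; lra).
  assert (0 <= sinh a) by (unfold sinh; lra).
  pose proof (Rabs_pos (sin b)); nra.
- unfold coth_im'; fold D; eapply Rle_trans; [apply (K2 _ 5) | lra].
  assert (1 <= cosh a) by (unfold cosh; lra).
  assert (cosh a + 1 <= 5 * D) by (unfold D, cosh; lra).
  apply Rabs_le; nra.
Qed.

Lemma continuous_scal_R (c : R) (f : R -> R) (x : R) :
  continuous f x -> continuous (fun t => c * f t) x.
Proof. exact (continuous_scal_r (V := R_NormedModule) c f x). Qed.

Lemma coth_re_opp (a b : R) : coth_re (- a) b = - coth_re a b.
Proof.
unfold coth_re, sinh, cosh; rewrite Ropp_involutive.
rewrite (Rplus_comm (exp (- a))); unfold Rdiv; ring.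
Qed.

Lemma coth_im_opp (a b : R) : coth_im (- a) b = coth_im a b.
Proof.
unfold coth_im, cosh; rewrite Ropp_involutive, (Rplus_comm (exp (- a))); reflexivity.
Qed.

(** The bound of [weighted_side_bound] with [mu] and [nu] for the side, where 40 is twice the tail
    constant 20 (two coth terms) and the factor [k] in the derivative comes from the scaling of
    y. *)
Definition side_error (h k U0 V0 A mu nu : R) : R :=
  (mu + h * Rabs U0) * (40 * exp (- A) + h * (k * (40 * exp (- A))))
  + 2 * h * (nu + Rabs V0) * (40 * exp (- A)).

(** * One vertical side at scaled distance [A], with [sg] telling right from left *)

Section Sides.

Variables (h k y0 U0 V0 A mu nu sg : R) (u v : R -> R).
Hypothesis h_pos : 0 < h.
Hypothesis k_pos : 0 < k.
Hypothesis A_large : 3 <= A.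
Hypothesis sg_unit : sg = 1 \/ sg = -1.
Hypothesis uv_cont : forall y, 0 <= y <= h -> continuous u y /\ continuous v y.
Hypothesis uv_bound : forall y, 0 <= y <= h -> Rabs (RInt u 0 y) <= mu /\ Rabs (v y) <= nu.

Let b1 (y : R) : R := k * (y - y0).
Let b2 (y : R) : R := k * (y + y0).

Lemma coth_sign (b : R) :
  coth_re (sg * A) b = sg * coth_re A b /\ coth_im (sg * A) b = coth_im A b.
Proof.
destruct sg_unit as [-> | ->].
- rewrite !Rmult_1_l; split; reflexivity.
- replace (-1 * A) with (- A) by ring; rewrite coth_re_opp, coth_im_opp; split; ring.
Qed.

Lemma sg_mult_abs (t : R) : Rabs (sg * t) = Rabs t.
Proof.
destruct sg_unit as [-> | ->]; [f_equal; ring |].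
replace (-1 * t) with (- t) by ring; apply Rabs_Ropp.
Qed.

Lemma is_derive_coth_shift (c : R) (y : R) :
  is_derive (fun y => coth_re A (k * (y + c))) y (k * coth_re' A (k * (y + c))) /\
  is_derive (fun y => coth_im A (k * (y + c))) y (k * coth_im' A (k * (y + c))).
Proof.
assert (HA : A <> 0) by lra.
assert (D : is_derive (fun y => k * (y + c)) y k) by (auto_derive; [exact I | ring]).
split.
- apply (is_derive_comp (coth_re A) (fun y => k * (y + c)));
    [apply is_derive_coth_re, HA | exact D].
- apply (is_derive_comp (coth_im A) (fun y => k * (y + c)));
    [apply is_derive_coth_im, HA | exact D].
Qed.

Lemma continuous_coth_shift (c : R) (y : R) :
  continuous (fun y => k * coth_re' A (k * (y + c))) y /\
  continuous (fun y => k * coth_im' A (k * (y + c))) y.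
Proof.
assert (HA : A <> 0) by lra.
assert (D : continuous (fun y => k * (y + c)) y).
{ apply (ex_derive_continuous (V := R_NormedModule)); auto_derive; exact I. }
destruct (continuous_coth_deriv A (k * (y + c)) HA) as [C1 C2].
split; apply continuous_scal_R.
- apply (continuous_comp (fun y => k * (y + c)) (coth_re' A)); assumption.
- apply (continuous_comp (fun y => k * (y + c)) (coth_im' A)); assumption.
Qed.

Lemma coth_shift_continuous (c : R) (y : R) :
  continuous (fun y => coth_re A (k * (y + c))) y /\
  continuous (fun y => coth_im A (k * (y + c))) y.
Proof.
destruct (is_derive_coth_shift c y) as [D1 D2].
split; apply (ex_derive_continuous (V := R_NormedModule)); eexists; eassumption.
Qed.

Lemma Rabs_combine (x y e : R) : Rabs x <= e -> Rabs y <= e ->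
  Rabs (x + y) <= 2 * e /\ Rabs (x - y) <= 2 * e.
Proof.
intros H1 H2; split; (eapply Rle_trans; [apply Rabs_triang |]); rewrite ?Rabs_Ropp; lra.
Qed.

(** Each [coth_re] tends to [sg], so the weight of [u - U0] splits into [2 * sg] and an
    exponentially small rest; this is how the integral of [u] over the side survives. *)
Lemma side_re_bound :
  Rabs (RInt (fun y =>
      (u y - U0) * (coth_re (sg * A) (b1 y) + coth_re (sg * A) (b2 y))
      + ((v y - V0) * coth_im (sg * A) (b1 y) + (v y + V0) * coth_im (sg * A) (b2 y))) 0 h
    - 2 * sg * (RInt u 0 h - h * U0))
  <= side_error h k U0 V0 A mu nu.
Proof.
assert (Hh : 0 <= h) by lra.
assert (Hex := exp_pos (- A)).
destruct (weighted_side_bound h U0 V0 mu nu (40 * exp (- A)) (k * (40 * exp (- A))) u v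
  (fun y => sg * (coth_re A (k * (y + - y0)) + coth_re A (k * (y + y0)) - 2))
  (fun y => sg * (k * coth_re' A (k * (y + - y0)) + k * coth_re' A (k * (y + y0))))
  (fun y => coth_im A (k * (y + - y0))) (fun y => coth_im A (k * (y + y0))))
  as [I B]; try assumption.
- intros y _; apply (is_derive_scal (fun y => coth_re A (k * (y + - y0))
    + coth_re A (k * (y + y0)) - 2) y sg).
  rewrite <- (Rminus_0_r (k * coth_re' A (k * (y + - y0)) + k * coth_re' A (k * (y + y0)))).
  apply (is_derive_minus (V := R_NormedModule)
    (fun y => coth_re A (k * (y + - y0)) + coth_re A (k * (y + y0))) (fun _ => 2));
    [| apply (is_derive_const (V := R_NormedModule))].
  apply (is_derive_plus (V := R_NormedModule) (fun y => coth_re A (k * (y + - y0)))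
    (fun y => coth_re A (k * (y + y0)))); apply is_derive_coth_shift.
- intros y _; split; [| split; exact (proj2 (coth_shift_continuous _ y))].
  apply (continuous_scal_R sg (fun y => k * coth_re' A (k * (y + - y0))
    + k * coth_re' A (k * (y + y0)))).
  apply (continuous_plus (fun y => k * coth_re' A (k * (y + - y0)))
    (fun y => k * coth_re' A (k * (y + y0)))).
  + exact (proj1 (continuous_coth_shift (- y0) y)).
  + exact (proj1 (continuous_coth_shift y0 y)).
- intros y _.
  destruct (coth_tail_bounds A (k * (y + - y0)) A_large) as (P1 & P2 & P3 & P4).
  destruct (coth_tail_bounds A (k * (y + y0)) A_large) as (Q1 & Q2 & Q3 & Q4).
  rewrite !sg_mult_abs; repeat split; try lra.
  + replace (coth_re A (k * (y + - y0)) + coth_re A (k * (y + y0)) - 2)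
      with ((coth_re A (k * (y + - y0)) - 1) + (coth_re A (k * (y + y0)) - 1)) by ring.
    eapply Rle_trans; [apply (Rabs_combine _ _ _ P1 Q1) | lra].
  + rewrite <- Rmult_plus_distr_l, Rabs_mult, (Rabs_right k) by lra.
    apply Rmult_le_compat_l; [lra |].
    eapply Rle_trans; [apply (Rabs_combine _ _ _ P3 Q3) | lra].
- assert (Iu : ex_RInt u 0 h) by (apply ex_RInt_of_continuous; [lra | apply uv_cont]).
  assert (Iu0 : ex_RInt (fun y => u y - U0) 0 h)
    by apply (ex_RInt_minus u (fun _ => U0) _ _ Iu (ex_RInt_const 0 h U0)).
  assert (E : 2 * sg * (RInt u 0 h - h * U0) = RInt (fun y => 2 * sg * (u y - U0)) 0 h).
  { rewrite <- (RInt_scal_R (2 * sg) (fun y => u y - U0)), (RInt_minus_R u (fun _ => U0)),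
      RInt_const_R by (assumption || apply ex_RInt_const); ring. }
  eapply Rle_trans; [| exact B]; apply Req_le; f_equal.
  rewrite E, <- RInt_minus_R; [| | exact (ex_RInt_scal (V := R_NormedModule) _ 0 h (2 * sg) Iu0)].
  + apply RInt_ext_R; [lra |]; intros y _; unfold b1, b2, Rminus.
    rewrite !(proj1 (coth_sign _)), !(proj2 (coth_sign _)); ring.
  + eapply ex_RInt_ext_R; [lra | |
      exact (ex_RInt_plus _ _ _ _ I (ex_RInt_scal (V := R_NormedModule) _ 0 h (2 * sg) Iu0))].
    intros y _; unfold b1, b2, Rminus.
    rewrite !(proj1 (coth_sign _)), !(proj2 (coth_sign _)).
    unfold plus, scal; simpl; unfold mult; simpl; ring.
Qed.

(** Here the limits cancel against [u], and (v + V0) - (v - V0) = 2 V0 eliminates [v]: the main term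
    involves nothing but the constant [V0]. *)
Lemma side_im_bound :
  Rabs (RInt (fun y =>
      (u y - U0) * (coth_im (sg * A) (b1 y) - coth_im (sg * A) (b2 y))
      + ((v y + V0) * coth_re (sg * A) (b2 y) - (v y - V0) * coth_re (sg * A) (b1 y))) 0 h
    - 2 * sg * (h * V0))
  <= side_error h k U0 V0 A mu nu.
Proof.
assert (Hh : 0 <= h) by lra.
assert (Hex := exp_pos (- A)).
assert (CR : forall s c y, continuous (fun y => s * (coth_re A (k * (y + c)) - 1)) y).
{ intros s c y; apply (continuous_scal_R s (fun y => coth_re A (k * (y + c)) - 1)).
  apply (continuous_minus (fun y => coth_re A (k * (y + c))) (fun _ => 1));
    [exact (proj1 (coth_shift_continuous c y)) | apply continuous_const]. }
destruct (weighted_side_bound h U0 V0 mu nu (40 * exp (- A)) (k * (40 * exp (- A))) u v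
  (fun y => coth_im A (k * (y + - y0)) - coth_im A (k * (y + y0)))
  (fun y => k * coth_im' A (k * (y + - y0)) - k * coth_im' A (k * (y + y0)))
  (fun y => - sg * (coth_re A (k * (y + - y0)) - 1))
  (fun y => sg * (coth_re A (k * (y + y0)) - 1)))
  as [I B]; try assumption.
- intros y _.
  apply (is_derive_minus (V := R_NormedModule) (fun y => coth_im A (k * (y + - y0)))
    (fun y => coth_im A (k * (y + y0)))); apply is_derive_coth_shift.
- intros y _; split; [| split; apply CR].
  apply (continuous_minus (fun y => k * coth_im' A (k * (y + - y0)))
    (fun y => k * coth_im' A (k * (y + y0)))).
  + exact (proj2 (continuous_coth_shift (- y0) y)).
  + exact (proj2 (continuous_coth_shift y0 y)).
- intros y _.
  destruct (coth_tail_bounds A (k * (y + - y0)) A_large) as (P1 & P2 & P3 & P4).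
  destruct (coth_tail_bounds A (k * (y + y0)) A_large) as (Q1 & Q2 & Q3 & Q4).
  rewrite Ropp_mult_distr_l_reverse, Rabs_Ropp, !sg_mult_abs; repeat split; try lra.
  + eapply Rle_trans; [apply (Rabs_combine _ _ _ P2 Q2) | lra].
  + rewrite <- Rmult_minus_distr_l, Rabs_mult, (Rabs_right k) by lra.
    apply Rmult_le_compat_l; [lra |].
    eapply Rle_trans; [apply (Rabs_combine _ _ _ P4 Q4) | lra].
- replace (2 * sg * (h * V0)) with (2 * sg * V0 * (h - 0)) by ring.
  rewrite <- RInt_const_R.
  eapply Rle_trans; [| exact B]; apply Req_le; f_equal.
  rewrite <- RInt_minus_R; [| | apply ex_RInt_const].
  + apply RInt_ext_R; [lra |]; intros y _; unfold b1, b2, Rminus.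
    rewrite !(proj1 (coth_sign _)), !(proj2 (coth_sign _)); ring.
  + eapply ex_RInt_ext_R; [lra | |
      exact (ex_RInt_plus _ _ _ _ I (ex_RInt_const 0 h (2 * sg * V0)))].
    intros y _; unfold b1, b2, Rminus.
    rewrite !(proj1 (coth_sign _)), !(proj2 (coth_sign _)).
    unfold plus; simpl; ring.
Qed.

End Sides.

(** * Letting the rectangle exhaust the strip *)

Definition is_RInt_line (f : R -> R) (l : R) : Prop :=
  is_RInt_gen f (Rbar_locally m_infty) (Rbar_locally p_infty) l.

Lemma is_RInt_line_of_eps (f : R -> R) (l : R) :
  (forall a b, a <= b -> ex_RInt f a b) ->
  (forall eps, 0 < eps -> exists N, forall a b, a <= - N -> N <= b ->
     Rabs (RInt f a b - l) <= eps) ->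
  is_RInt_line f l.
Proof.
intros Hex H; apply filterlimi_locally; intros eps.
destruct (H (eps / 2)) as [N HN]; [pose proof (cond_pos eps); lra |].
apply Filter_prod with (fun a => a < - Rmax N 0) (fun b => Rmax N 0 < b).
- exists (- Rmax N 0); auto.
- exists (Rmax N 0); auto.
- intros a b Ha Hb; simpl.
  assert (M1 := Rmax_l N 0); assert (M2 := Rmax_r N 0).
  exists (RInt f a b); split.
  + apply (RInt_correct (V := R_CompleteNormedModule)), Hex; lra.
  + change (Rabs (RInt f a b - l) < eps).
    apply Rle_lt_trans with (eps / 2); [apply HN; lra | pose proof (cond_pos eps); lra].
Qed.

Lemma is_RInt_line_eps (f : R -> R) (l : R) :
  is_RInt_line f l ->
  forall eps, 0 < eps -> exists N, forall a b, a <= - N -> N <= b ->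
    Rabs (RInt f a b - l) <= eps.
Proof.
intros H eps Heps.
destruct (proj1 (filterlimi_locally (fun ab => is_RInt f (fst ab) (snd ab)) l) H
  (mkposreal eps Heps)) as [Q1 Q2 [N1 H1] [N2 H2] H'].
(* The filters demand the strict inequalities a < N1 and b > N2. *)
exists (Rmax (1 - N1) (N2 + 1)); intros a b Ha Hb.
assert (M1 := Rmax_l (1 - N1) (N2 + 1)); assert (M2 := Rmax_r (1 - N1) (N2 + 1)).
destruct (H' a b) as (z & Hz & Hl); [apply H1; lra | apply H2; lra |]; simpl in Hz, Hl.
apply (is_RInt_unique (V := R_CompleteNormedModule)) in Hz; rewrite Hz.
apply Rlt_le; exact Hl.
Qed.

Lemma limit_of_cauchy_at_infinity (phi : R -> R) :
  (forall eps, 0 < eps -> exists N, forall x y, N <= x -> N <= y ->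
     Rabs (phi x - phi y) <= eps) ->
  exists l, forall eps, 0 < eps -> exists N, forall x, N <= x -> Rabs (phi x - l) <= eps.
Proof.
intros H.
assert (HN : forall N, exists n, forall m, (n <= m)%nat -> N <= INR m).
{ intros N; destruct (INR_unbounded N) as [n Hn]; exists n; intros m Hm.
  apply le_INR in Hm; lra. }
destruct (Rcomplete.R_complete (fun n => phi (INR n))) as [l Hl].
{ intros eps Heps; destruct (H (eps / 2)) as [N HN1]; [lra |].
  destruct (HN N) as [n Hn]; exists n; intros p q Hp Hq.
  unfold Rdist; apply Rle_lt_trans with (eps / 2); [apply HN1; apply Hn; assumption | lra]. }
exists l; intros eps Heps.
destruct (H (eps / 2)) as [N HN1]; [lra |].
exists N; intros x Hx.
destruct (Hl (eps / 2)) as [n Hn]; [lra |].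
destruct (HN N) as [n' Hn'].
specialize (Hn (max n n') (PeanoNat.Nat.le_max_l _ _)); unfold Rdist in Hn.
specialize (Hn' (max n n') (PeanoNat.Nat.le_max_r _ _)).
specialize (HN1 x (INR (max n n')) Hx Hn').
apply Rabs_le_between in HN1; apply Rlt_le, Rabs_le_between in Hn; apply Rabs_le; lra.
Qed.

Lemma exp_growth (k C : R) : 0 < k -> exists N, forall x, N <= x -> C <= exp (k * x).
Proof.
intros Hk; exists (Rmax 1 (C / k)); intros x Hx.
assert (M1 := Rmax_l 1 (C / k)); assert (M2 := Rmax_r 1 (C / k)).
assert (0 < k * x) by (apply Rmult_lt_0_compat; lra).
assert (E := exp_ineq1 (k * x) ltac:(lra)).
assert (C <= k * x); [| lra].
replace C with (k * (C / k)) by (field; lra).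
apply Rmult_le_compat_l; lra.
Qed.

Lemma RInt_exp (k a b : R) : 0 < k -> a <= b ->
  is_RInt (fun t => exp (k * t)) a b ((exp (k * b) - exp (k * a)) / k).
Proof.
intros Hk Hab.
replace ((exp (k * b) - exp (k * a)) / k)
  with (minus (exp (k * b) / k) (exp (k * a) / k))
  by (unfold minus, plus, opp; simpl; field; lra).
apply (is_RInt_derive (fun t => exp (k * t) / k)); intros t _.
- auto_derive; [exact I | field; lra].
- apply (ex_derive_continuous (V := R_NormedModule)); auto_derive; exact I.
Qed.

(** The threshold [N1] for [v] is fixed before [X]; the integral beyond it is o(e^(k X)) like [v],
    and the starting value [m N1 y], bounded in [y], is absorbed once the exponential is large. *)
Lemma primitive_growth (k h : R) (m v : R -> R -> R) :
  0 < k ->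
  (forall X0 X y, X0 <= X -> 0 <= y <= h ->
     ex_RInt (fun t => v t y) X0 X /\ m X y - m X0 y = RInt (fun t => v t y) X0 X) ->
  (forall X, exists C, forall y, 0 <= y <= h -> Rabs (m X y) <= C) ->
  (forall eps, 0 < eps -> exists N, forall X y, N <= X -> 0 <= y <= h ->
     Rabs (v X y) <= eps * exp (k * X)) ->
  forall eps, 0 < eps -> exists N, forall X y, N <= X -> 0 <= y <= h ->
     Rabs (m X y) <= eps * exp (k * X).
Proof.
intros Hk Hm Hb Hv eps Heps.
(* Integrating e^(k t) divides by [k], which leaves [eps / 2]; the other half absorbs [m N1 y]. *)
destruct (Hv (eps * k / 2)) as [N1 HN1]; [apply Rdiv_lt_0_compat; nra |].
destruct (Hb N1) as [C HC].
destruct (exp_growth k (2 * C / eps) Hk) as [N2 HN2].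
exists (Rmax N1 N2); intros X y HX Hy.
assert (M1 := Rmax_l N1 N2); assert (M2 := Rmax_r N1 N2).
destruct (Hm N1 X y) as [I E]; [lra | exact Hy |].
assert (HC' : C <= eps / 2 * exp (k * X)).
{ specialize (HN2 X ltac:(lra)).
  apply Rmult_le_compat_l with (r := eps / 2) in HN2; [| lra].
  replace (eps / 2 * (2 * C / eps)) with C in HN2 by (field; lra); exact HN2. }
assert (B : Rabs (RInt (fun t => v t y) N1 X) <= eps / 2 * exp (k * X)).
{ apply Rle_trans with (RInt (fun t => Rabs (v t y)) N1 X);
    [apply abs_RInt_le; [lra | exact I] |].
  assert (Ie := is_RInt_scal (V := R_NormedModule) _ _ _ (eps * k / 2) _
    (RInt_exp k N1 X Hk ltac:(lra))).
  apply Rle_trans with (eps * k / 2 * ((exp (k * X) - exp (k * N1)) / k)).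
  - assert (Eu := is_RInt_unique (V := R_CompleteNormedModule) _ _ _ _ Ie).
    change (RInt (fun t => eps * k / 2 * exp (k * t)) N1 X =
      eps * k / 2 * ((exp (k * X) - exp (k * N1)) / k)) in Eu; rewrite <- Eu.
    apply RInt_le; [lra | apply (ex_RInt_norm (fun t => v t y) N1 X), I
      | eexists; exact Ie |].
    intros t Ht; apply HN1; [lra | exact Hy].
  - replace (eps * k / 2 * ((exp (k * X) - exp (k * N1)) / k))
      with (eps / 2 * exp (k * X) - eps / 2 * exp (k * N1)) by (field; lra).
    assert (0 < eps / 2 * exp (k * N1)) by (apply Rmult_lt_0_compat; [lra | apply exp_pos]).
    lra. }
specialize (HC y Hy).
replace (m X y) with (m N1 y + RInt (fun t => v t y) N1 X) by lra.
eapply Rle_trans; [apply Rabs_triang | lra].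
Qed.

(** At [y0 = 0] the cosine in the conjugate kernel is 1, and this identity turns the kernel into
    tanh. *)
Lemma tanh_half (w : R) : tanh w = sinh (2 * w) / (cosh (2 * w) + 1).
Proof.
assert (E := exp_pos w).
assert (Hab : exp w * exp (- w) = 1) by (rewrite <- exp_plus, Rplus_opp_r; apply exp_0).
assert (E' := exp_pos (- w)).
unfold tanh, sinh, cosh.
replace (2 * w) with (w + w) by ring; rewrite Ropp_plus_distr, !exp_plus.
set (p := exp w) in *; set (q := exp (- w)) in *.
replace ((p * p + q * q) / 2 + 1) with ((p + q) * (p + q) / 2)
  by (replace 1 with (p * q); field).
field; nra.
Qed.

(** * Growth of the cross-section integrals and asymptotics of the top integral *)

Section StripLimit.

Variables (h : R) (F : C -> C).
Hypothesis h_pos : 0 < h.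
Hypothesis F_deriv : forall x y, 0 <= y <= h -> exists l, is_Cderive F (x, y) l.
Hypothesis F_real : forall x, Im (F (x, 0)) = 0.

Let k : R := PI / h.
Let u (x y : R) : R := Re (F (x, y)).
Let v (x y : R) : R := Im (F (x, y)).
Let M (x y : R) : R := RInt (u x) 0 y.

Hypothesis v_growth : forall eps, 0 < eps -> exists N, forall x y,
  N <= Rabs x -> 0 <= y <= h -> Rabs (v x y) <= eps * exp (k * Rabs x).

Lemma strip_continuous (x y : R) : 0 <= y <= h ->
  continuous (u x) y /\ continuous (v x) y /\ continuous (fun t => v t y) x.
Proof.
intros Hy; destruct (F_deriv x y Hy) as [l Hl].
destruct (is_Cderive_closed_forms F x y l Hl) as [H1 H2].
destruct (closed_form_at_continuous _ _ _ _ H1) as [C1 C2].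
destruct (closed_form_at_continuous _ _ _ _ H2) as [C3 C4].
split; [exact C2 | split; [| exact C1]].
apply (continuous_ext (fun s => - - v x s)); [intros; apply Ropp_involutive |].
apply (continuous_opp (fun s => - v x s)); exact C4.
Qed.

Lemma ex_RInt_v (a b y : R) : a <= b -> 0 <= y <= h -> ex_RInt (fun t => v t y) a b.
Proof.
intros Hab Hy; apply ex_RInt_of_continuous; [exact Hab |]; intros t _.
exact (proj2 (proj2 (strip_continuous t y Hy))).
Qed.

(** Cauchy's theorem for the imaginary part of F dz on [a, b] x [0, y]; the bottom side vanishes as
    [F] is real there. *)
Lemma side_primitive_diff (a b y : R) : a <= b -> 0 <= y <= h ->
  M b y - M a y = RInt (fun t => v t y) a b.
Proof.
intros Hab Hy.
assert (E : rect_int v u a b 0 y = 0).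
{ apply goursat; [exact Hab | lra |]; intros x s _ Hs.
  destruct (F_deriv x s) as [l Hl]; [lra |].
  apply (is_Cderive_closed_forms F x s l Hl). }
unfold rect_int in E.
rewrite (RInt_ext_R (fun t => v t 0) (fun _ => 0)), RInt_const_R in E
  by (exact Hab || (intros; apply F_real)).
change (RInt (fun s => u b s) 0 y - RInt (fun s => u a s) 0 y
  = RInt (fun t => v t y) a b :> R); lra.
Qed.

Lemma side_primitive_bounded (x : R) :
  exists C, forall y, 0 <= y <= h -> Rabs (M x y) <= C.
Proof.
destruct (bounded_continuity (V := R_NormedModule) (u x) 0 h) as [C HC].
{ intros y Hy; exact (proj1 (strip_continuous x y Hy)). }
exists (h * C); intros y Hy.
assert (Hu : forall s, 0 <= s <= y -> Rabs (u x s) <= C)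
  by (intros s Hs; apply Rlt_le, HC; lra).
assert (0 <= C) by (eapply Rle_trans; [apply Rabs_pos | apply (Hu 0); lra]).
apply Rle_trans with ((y - 0) * C).
- apply abs_RInt_le_const; [lra | | exact Hu].
  apply ex_RInt_of_continuous; [lra |]; intros s Hs.
  exact (proj1 (strip_continuous x s ltac:(lra))).
- apply Rmult_le_compat_r; lra.
Qed.

Lemma strip_growth (eps : R) : 0 < eps -> exists N, forall x y,
  N <= Rabs x -> 0 <= y <= h ->
  Rabs (M x y) <= eps * exp (k * Rabs x) /\ Rabs (v x y) <= eps * exp (k * Rabs x).
Proof.
intros Heps; assert (Hk := strip_scale_pos h h_pos); fold k in Hk.
destruct (v_growth eps Heps) as [N0 HN0].
destruct (primitive_growth k h M v Hk) with (eps := eps) as [N1 HN1]; try assumption.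
{ intros X0 X y HX Hy; split; [apply ex_RInt_v | apply side_primitive_diff]; assumption. }
{ apply side_primitive_bounded. }
{ intros e He; destruct (v_growth e He) as [N HN]; exists (Rmax N 0); intros X y HX Hy.
  assert (L1 := Rmax_l N 0); assert (L2 := Rmax_r N 0).
  specialize (HN X y); rewrite (Rabs_right X) in HN by lra; apply HN; lra. }
(* The left end is reflected to the right; the sign of [v] changes because the integration is
   reversed. *)
destruct (primitive_growth k h (fun x y => M (- x) y) (fun x y => - v (- x) y) Hk)
  with (eps := eps) as [N2 HN2]; try assumption.
{ intros X0 X y HX Hy.
  assert (I := ex_RInt_v (- X) (- X0) y ltac:(lra) Hy).
  assert (D := side_primitive_diff (- X) (- X0) y ltac:(lra) Hy).
  assert (J := RInt_correct (V := R_CompleteNormedModule) _ _ _ I).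
  apply (is_RInt_swap (V := R_NormedModule)) in J.
  apply (is_RInt_comp_opp (V := R_NormedModule)) in J.
  split; [eexists; exact J |].
  apply (is_RInt_unique (V := R_CompleteNormedModule)) in J.
  change (RInt (fun t => - v (- t) y) X0 X = - RInt (fun t => v t y) (- X) (- X0)) in J.
  change (M (- X) y - M (- X0) y = RInt (fun t => - v (- t) y) X0 X :> R).
  rewrite J; lra. }
{ intros X; apply side_primitive_bounded. }
{ intros e He; destruct (v_growth e He) as [N HN]; exists (Rmax N 0); intros X y HX Hy.
  assert (L1 := Rmax_l N 0); assert (L2 := Rmax_r N 0).
  rewrite Rabs_Ropp.
  specialize (HN (- X) y); rewrite Rabs_Ropp, (Rabs_right X) in HN by lra; apply HN; lra. }
exists (Rmax N0 (Rmax N1 N2)); intros x y Hx Hy.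
assert (L1 := Rmax_l N0 (Rmax N1 N2)); assert (L2 := Rmax_r N0 (Rmax N1 N2)).
assert (L3 := Rmax_l N1 N2); assert (L4 := Rmax_r N1 N2).
split; [| apply HN0; lra].
destruct (Rle_lt_dec 0 x).
- rewrite (Rabs_right x) in * by lra; apply HN1; lra.
- rewrite (Rabs_left x) in * by lra.
  specialize (HN2 (- x) y); rewrite Ropp_involutive in HN2; apply HN2; lra.
Qed.

(** Growth d e^(k |X|) meets decay e^(-k |X - x0|), and their product stays below d e^(k |x0|). The
    exponents match exactly, so the smallness comes entirely from the freedom to choose [d]. *)
Lemma side_error_small (x0 U0 V0 eps : R) : 0 < eps -> exists N, Rabs x0 < N /\
  forall X, N <= Rabs X -> 3 <= k * Rabs (X - x0) /\
  exists mu, (forall y, 0 <= y <= h -> Rabs (M X y) <= mu /\ Rabs (v X y) <= mu) /\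
    side_error h k U0 V0 (k * Rabs (X - x0)) mu mu <= eps.
Proof.
intros Heps; assert (Hk := strip_scale_pos h h_pos); fold k in Hk.
assert (E0 := exp_pos (k * Rabs x0)).
(* [c] collects the factors left in [side_error] once [Rabs U0] and [Rabs V0] are below d e^(k |X|),
   which [N2] and [N3] ensure; [N4] makes the scaled distance at least 3. *)
pose (c := (1 + h) * (1 + h * k) + 4 * h).
assert (Hhk : 0 < h * k) by (apply Rmult_lt_0_compat; assumption).
assert (Hc : 0 < c) by (unfold c; nra).
pose (K := 40 * exp (k * Rabs x0) * c).
assert (HK : 0 < K) by (unfold K; repeat apply Rmult_lt_0_compat; lra).
pose (d := eps / K).
assert (Hd : 0 < d) by (apply Rdiv_lt_0_compat; assumption).
destruct (strip_growth d Hd) as [N1 HN1].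
destruct (exp_growth k (Rabs U0 / d) Hk) as [N2 HN2].
destruct (exp_growth k (Rabs V0 / d) Hk) as [N3 HN3].
pose (N4 := Rabs x0 + 3 / k).
assert (H3k : 0 < 3 / k) by (apply Rdiv_lt_0_compat; lra).
exists (Rmax (Rmax N1 N2) (Rmax N3 N4)).
assert (L1 := Rmax_l (Rmax N1 N2) (Rmax N3 N4)).
assert (L2 := Rmax_r (Rmax N1 N2) (Rmax N3 N4)).
assert (L3 := Rmax_l N1 N2); assert (L4 := Rmax_r N1 N2).
assert (L5 := Rmax_l N3 N4); assert (L6 := Rmax_r N3 N4).
split; [unfold N4 in *; lra |]; intros X HX.
assert (T : Rabs X - Rabs x0 <= Rabs (X - x0)) by apply Rabs_triang_inv.
split.
{ replace 3 with (k * (3 / k)) by (field; lra).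
  apply Rmult_le_compat_l; [lra | unfold N4 in *; lra]. }
exists (d * exp (k * Rabs X)); split; [intros y Hy; apply HN1; lra |].
assert (S : forall t, Rabs t / d <= exp (k * Rabs X) -> Rabs t <= d * exp (k * Rabs X)).
{ intros t Ht; replace (Rabs t) with (d * (Rabs t / d)) by (field; lra).
  apply Rmult_le_compat_l; lra. }
assert (HU := S U0 (HN2 (Rabs X) ltac:(lra))).
assert (HV := S V0 (HN3 (Rabs X) ltac:(lra))).
set (E := exp (k * Rabs X)) in *; set (A := k * Rabs (X - x0)).
assert (HE : 0 < E) by apply exp_pos.
assert (HA : 0 < exp (- A)) by apply exp_pos.
assert (HEA : exp (- A) * E <= exp (k * Rabs x0)).
{ unfold E; rewrite <- exp_plus.
  apply Rnot_lt_le; intros Hlt; apply exp_lt_inv in Hlt.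
  assert (k * (Rabs X - Rabs x0) <= A) by (apply Rmult_le_compat_l; lra); lra. }
apply Rle_trans with (40 * (exp (- A) * E) * d * c).
- unfold side_error, c.
  assert (B1 : d * E + h * Rabs U0 <= d * E * (1 + h)) by nra.
  assert (B2 : d * E + Rabs V0 <= 2 * (d * E)) by lra.
  replace (40 * (exp (- A) * E) * d * ((1 + h) * (1 + h * k) + 4 * h))
    with (d * E * (1 + h) * (40 * exp (- A) + h * (k * (40 * exp (- A))))
      + 2 * h * (2 * (d * E)) * (40 * exp (- A))) by ring.
  assert (P1 : 0 < 40 * exp (- A)) by lra.
  assert (P2 : 0 < h * (k * (40 * exp (- A))))
    by (apply Rmult_lt_0_compat; [| apply Rmult_lt_0_compat]; lra).
  apply Rplus_le_compat.
  + apply Rmult_le_compat_r; lra.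
  + apply Rmult_le_compat_r; [lra |]; apply Rmult_le_compat_l; lra.
- replace eps with (40 * exp (k * Rabs x0) * d * c) by (unfold d, K; field; split; lra).
  apply Rmult_le_compat_r; [lra |]; apply Rmult_le_compat_r; lra.
Qed.

Section Point.

Variables (x0 y0 : R).
Hypothesis y0_range : 0 <= y0 < h.

Let G1 : C -> C := coth_quotient F k (F (x0, y0)) (x0, y0).
Let G2 : C -> C := coth_quotient F k (Cconj (F (x0, y0))) (Cconj (x0, y0)).

Lemma side_estimates (X sg mu : R) :
  sg = 1 \/ sg = -1 -> X - x0 = sg * Rabs (X - x0) -> 3 <= k * Rabs (X - x0) ->
  (forall y, 0 <= y <= h -> Rabs (M X y) <= mu /\ Rabs (v X y) <= mu) ->
  let err := side_error h k (u x0 y0) (v x0 y0) (k * Rabs (X - x0)) mu mu in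
  Rabs (RInt (fun y => Re (G1 (X, y) + G2 (X, y))) 0 h
    - 2 * sg * (M X h - h * u x0 y0)) <= err /\
  Rabs (RInt (fun y => - Im (G1 (X, y) - G2 (X, y))) 0 h - 2 * sg * (h * v x0 y0)) <= err.
Proof.
intros Hsg HX HA Hb err; assert (Hk := strip_scale_pos h h_pos); fold k in Hk.
assert (Hne : X <> x0).
{ intros ->; rewrite Rminus_diag, Rabs_R0 in HA; lra. }
assert (Ek : k * (X - x0) = sg * (k * Rabs (X - x0))) by (rewrite HX at 1; ring).
assert (Cuv : forall y, 0 <= y <= h -> continuous (u X) y /\ continuous (v X) y).
{ intros y Hy; destruct (strip_continuous X y Hy) as (C1 & C2 & _); split; assumption. }
assert (V := fun y Hy => kernel_pair_value h F x0 y0 h_pos y0_range X y Hy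
  (or_introl Hne)); cbv zeta in V; fold k in V; fold G1 G2 in V.
split.
- rewrite (RInt_ext_R _ (fun y =>
    (u X y - u x0 y0) * (coth_re (sg * (k * Rabs (X - x0))) (k * (y - y0))
                         + coth_re (sg * (k * Rabs (X - x0))) (k * (y + y0)))
    + ((v X y - v x0 y0) * coth_im (sg * (k * Rabs (X - x0))) (k * (y - y0))
       + (v X y + v x0 y0) * coth_im (sg * (k * Rabs (X - x0))) (k * (y + y0))))); [| lra |].
  + apply side_re_bound; assumption.
  + intros y Hy; destruct (V y) as (R1 & I1 & R2 & I2); [lra |].
    transitivity (Re (G1 (X, y)) + Re (G2 (X, y))); [reflexivity |].
    rewrite R1, R2, Ek; unfold u, v; ring.
- rewrite (RInt_ext_R _ (fun y =>
    (u X y - u x0 y0) * (coth_im (sg * (k * Rabs (X - x0))) (k * (y - y0))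
                         - coth_im (sg * (k * Rabs (X - x0))) (k * (y + y0)))
    + ((v X y + v x0 y0) * coth_re (sg * (k * Rabs (X - x0))) (k * (y + y0))
       - (v X y - v x0 y0) * coth_re (sg * (k * Rabs (X - x0))) (k * (y - y0))))); [| lra |].
  + apply side_im_bound; assumption.
  + intros y Hy; destruct (V y) as (R1 & I1 & R2 & I2); [lra |].
    transitivity (Im (G2 (X, y)) - Im (G1 (X, y))).
    { generalize (G1 (X, y)) (G2 (X, y)); intros [p q] [r s]; unfold Im; simpl; ring. }
    rewrite I1, I2, Ek; unfold u, v; ring.
Qed.

Let top_re (t : R) : R :=
  v t h * (sinh (k * (t - x0)) / (cosh (k * (t - x0)) + cos (k * y0))).
Let top_im (t : R) : R :=
  v t h * (sin (k * y0) / (cosh (k * (t - x0)) + cos (k * y0))).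

(** This is [cosh - cos] at vertical offset [h - y0], which is positive, since cos(PI - k y0) = -
    cos(k y0). *)
Lemma cosh_plus_cos_pos (a : R) : 0 < cosh a + cos (k * y0).
Proof.
assert (P := cosh_minus_cos_strip_pos h x0 h_pos (x0 + a / k) (h - y0)).
assert (Hk := strip_scale_pos h h_pos); fold k in P, Hk.
replace (k * (x0 + a / k - x0)) with a in P by (field; lra).
replace (k * (h - y0)) with (PI - k * y0) in P by (unfold k; field; lra).
rewrite Rtrigo_facts.cos_pi_minus in P.
specialize (P ltac:(lra) ltac:(right; lra)); lra.
Qed.

Lemma ex_RInt_top (a b : R) : a <= b -> ex_RInt top_re a b /\ ex_RInt top_im a b.
Proof.
intros Hab.
assert (Cv : forall t, continuous (fun t => v t h) t) 
  by (intros t; exact (proj2 (proj2 (strip_continuous t h ltac:(lra))))).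
split; apply ex_RInt_of_continuous; try exact Hab; intros t _;
  assert (P := cosh_plus_cos_pos (k * (t - x0))).
- apply (continuous_mult (fun t => v t h)); [apply Cv |].
  apply (ex_derive_continuous (V := R_NormedModule)); auto_derive; apply Rgt_not_eq, P.
- apply (continuous_mult (fun t => v t h)); [apply Cv |].
  apply (ex_derive_continuous (V := R_NormedModule)); auto_derive; apply Rgt_not_eq, P.
Qed.

(** The opposite signs of the two sides turn right minus left into a sum: [M b h + M a h] for the
    real kernel, and a constant for the other. The imaginary part is thus settled at once, while the
    real part still depends on the behaviour of [M] at both ends. *)
Lemma top_integral_asymptotics (eps : R) : 0 < eps -> exists N, forall a b,
  a <= - N -> N <= b ->
  Rabs (RInt top_re a b - (M b h + M a h - 2 * h * u x0 y0)) <= eps /\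
  Rabs (RInt top_im a b - 2 * h * v x0 y0) <= eps.
Proof.
intros Heps.
destruct (side_error_small x0 (u x0 y0) (v x0 y0) eps Heps) as (N & HN0 & HN).
exists N; intros a b Ha Hb.
assert (HNpos := Rabs_pos x0); apply Rabs_lt_between in HN0.
destruct (HN a) as (A1 & mu1 & B1 & S1); [rewrite Rabs_left; lra |].
destruct (HN b) as (A2 & mu2 & B2 & S2); [rewrite Rabs_right; lra |].
destruct (side_estimates a (-1) mu1) as [R1 I1]; try assumption.
{ right; reflexivity. }
{ rewrite Rabs_left; lra. }
destruct (side_estimates b 1 mu2) as [R2 I2]; try assumption.
{ left; reflexivity. }
{ rewrite Rabs_right; lra. }
destruct (contour_identities h F x0 y0 h_pos F_deriv F_real y0_range a b) as [J1 J2]; [lra |].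
fold k in J1, J2; fold G1 G2 in J1, J2.
destruct (ex_RInt_top a b) as [T1 T2]; [lra |].
assert (K1 : RInt (fun t => Im (G1 (t, h) + G2 (t, h))) a b = 2 * RInt top_re a b).
{ rewrite RInt_scal_R by exact T1; apply RInt_ext_R; [lra |]; intros t _.
  apply (kernel_pair_top h F x0 y0 h_pos y0_range). }
assert (K2 : RInt (fun t => Re (G1 (t, h) - G2 (t, h))) a b = 2 * RInt top_im a b).
{ rewrite RInt_scal_R by exact T2; apply RInt_ext_R; [lra |]; intros t _.
  apply (kernel_pair_top h F x0 y0 h_pos y0_range). }
rewrite K1 in J1; rewrite K2 in J2.
apply Rabs_le_between in R1, I1, R2, I2.
split; apply Rabs_le; lra.
Qed.

End Point.

End StripLimit.

(** * Passage to the line integrals and to the kernels of the statement *)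

Lemma RInt_line_of_is (f : R -> R) (l : R) :
  is_RInt_line f l -> ex_RInt_line f /\ RInt_line f = l.
Proof.
intros H; split; [exists l; exact H |].
exact (is_RInt_gen_unique (V := R_CompleteNormedModule) f l H).
Qed.

Lemma is_RInt_line_scal_ext (w f : R -> R) (c l m : R) :
  is_RInt_line w l -> (forall t, c * w t = f t) -> c * l = m -> is_RInt_line f m.
Proof.
intros Hw Hf <-.
refine (is_RInt_gen_ext (V := R_NormedModule) (fun t => c * w t) f (c * l) _ _).
- apply filter_forall; intros ab t _; apply Hf.
- exact (is_RInt_gen_scal (V := R_NormedModule) w c l Hw).
Qed.

Lemma sinh_opp (a : R) : sinh (- a) = - sinh a.
Proof. unfold sinh; rewrite Ropp_involutive; field. Qed.

Lemma cosh_opp (a : R) : cosh (- a) = cosh a.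
Proof. unfold cosh; rewrite Ropp_involutive; field. Qed.

Theorem theorem4p2 (h : R) (h_pos : 0 < h) (F : C -> C) (U V : R -> R -> R)
    (g : R -> R)
    (F_holo : holomorphic_near (closed_strip h) F)
    (F_UV : forall x y : R, 0 <= y <= h ->
       F (RtoC x + Ci * RtoC y)%C = (RtoC (U x y) + Ci * RtoC (V x y))%C)
    (V_bottom : forall x : R, V x 0 = 0)
    (V_top : forall x : R, V x h = g x)
    (V_growth : phragmen_lindelof h V) :
  (forall x y : R, 0 < y < h ->
     ex_conv (fun s => poisson_kernel h s y) g x /\
     V x y = conv (fun s => poisson_kernel h s y) g x) /\
  (ex_RInt_line g ->
   exists c : R,
     (forall x y : R, 0 < y < h ->
        ex_conv (fun s => conj_poisson_kernel h s y) g x /\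
        U x y = conv (fun s => conj_poisson_kernel h s y) g x + c) /\
     (forall x : R,
        ex_conv (fun s => 1 / (2 * h) * tanh (PI * s / (2 * h))) g x /\
        U x 0 =
          conv (fun s => 1 / (2 * h) * tanh (PI * s / (2 * h))) g x + c /\
        U x 0 =
          1 / (2 * h) * RInt_line (fun t => tanh (PI * (x - t) / (2 * h)) * g t)
          + c)).
Proof.
assert (F_deriv : forall x y, 0 <= y <= h -> exists l, is_Cderive F (x, y) l).
{ destruct F_holo as (D & _ & HD & HF); intros x y Hy.
  apply ex_Cderive_of_ex_derive, HF, HD; exact Hy. }
assert (HUV : forall x y, 0 <= y <= h -> Re (F (x, y)) = U x y /\ Im (F (x, y)) = V x y).
{ intros x y Hy; specialize (F_UV x y Hy); rewrite !RtoC_eq_pair in F_UV.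
  rewrite F_UV; split; reflexivity. }
assert (F_real : forall x, Im (F (x, 0)) = 0).
{ intros x; rewrite (proj2 (HUV x 0 ltac:(lra))); apply V_bottom. }
assert (v_growth : forall eps, 0 < eps -> exists N, forall x y,
  N <= Rabs x -> 0 <= y <= h -> Rabs (Im (F (x, y))) <= eps * exp (PI / h * Rabs x)).
{ intros eps Heps; destruct (V_growth eps Heps) as [N HN]; exists N; intros x y Hx Hy.
  rewrite (proj2 (HUV x y Hy)).
  replace (PI / h * Rabs x) with (PI * Rabs x / h) by (field; lra); auto. }
assert (Hg : forall t, Im (F (t, h)) = g t).
{ intros t; rewrite (proj2 (HUV t h ltac:(lra))); apply V_top. }
assert (Hk : forall s, PI / h * s = PI * s / h) by (intros s; field; lra).
assert (Hkt : forall x t, PI / h * (t - x) = - (PI * (x - t) / h)) by (intros; field; lra).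
pose (q := fun x y t => g t *
  (sinh (PI / h * (t - x)) / (cosh (PI / h * (t - x)) + cos (PI / h * y)))).
pose (p := fun x y t => g t *
  (sin (PI / h * y) / (cosh (PI / h * (t - x)) + cos (PI / h * y)))).
pose (M := fun X => RInt (fun s => Re (F (X, s))) 0 h).
assert (Iqp : forall x y, 0 <= y < h -> forall a b, a <= b ->
  ex_RInt (q x y) a b /\ ex_RInt (p x y) a b).
{ intros x y Hy a b Hab.
  destruct (ex_RInt_top h F h_pos F_deriv x y Hy a b Hab) as [I1 I2].
  split.
  - refine (ex_RInt_ext_R _ _ a b Hab _ I1); intros t _; unfold q; rewrite <- Hg; reflexivity.
  - refine (ex_RInt_ext_R _ _ a b Hab _ I2); intros t _; unfold p; rewrite <- Hg; reflexivity. }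
assert (Lim : forall x y, 0 <= y < h -> forall eps, 0 < eps -> exists N, forall a b,
  a <= - N -> N <= b ->
  (a <= b -> Rabs (RInt (q x y) a b - (M b + M a - 2 * h * U x y)) <= eps) /\
  (a <= b -> Rabs (RInt (p x y) a b - 2 * h * V x y) <= eps)).
{ intros x y Hy eps Heps.
  destruct (top_integral_asymptotics h F h_pos F_deriv F_real v_growth x y Hy eps Heps)
    as [N HN].
  exists N; intros a b Ha Hb; destruct (HN a b Ha Hb) as [B1 B2].
  rewrite (proj1 (HUV x y ltac:(lra))) in B1; rewrite (proj2 (HUV x y ltac:(lra))) in B2.
  split; intros Hab.
  - erewrite (RInt_ext_R (q x y)); [exact B1 | exact Hab |].
    intros t _; unfold q; rewrite <- Hg; reflexivity.
  - erewrite (RInt_ext_R (p x y)); [exact B2 | exact Hab |].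
    intros t _; unfold p; rewrite <- Hg; reflexivity. }
(* Replacing [N] by [Rmax N 0] makes [a <= b] automatic. *)
assert (Hext : forall (P : R -> R -> Prop),
  (exists N, forall a b, a <= - N -> N <= b -> a <= b -> P a b) ->
  exists N, forall a b, a <= - N -> N <= b -> P a b).
{ intros P [N HN]; exists (Rmax N 0); intros a b Ha Hb.
  assert (L1 := Rmax_l N 0); assert (L2 := Rmax_r N 0); apply HN; lra. }
split.
- intros x y Hy.
  assert (I : is_RInt_line (p x y) (2 * h * V x y)).
  { apply is_RInt_line_of_eps; [intros a b Hab; exact (proj2 (Iqp x y ltac:(lra) a b Hab)) |].
    intros eps Heps; apply Hext.
    destruct (Lim x y ltac:(lra) eps Heps) as [N HN]; exists N.
    intros a b Ha Hb; exact (proj2 (HN a b Ha Hb)). }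
  destruct (RInt_line_of_is (fun t => poisson_kernel h (x - t) y * g t) (V x y)) as [E1 E2].
  { apply is_RInt_line_scal_ext with (1 := I) (c := 1 / (2 * h)); [| field; lra].
    intros t; unfold p, poisson_kernel; rewrite Hkt, cosh_opp, Hk; ring. }
  split; [exact E1 | symmetry; exact E2].
- intros [l Hl].
  assert (Hgi := is_RInt_line_eps g l Hl).
  assert (HM : forall a b, a <= b -> RInt g a b = M b - M a).
  { intros a b Hab; symmetry; unfold M.
    assert (D := side_primitive_diff h F F_deriv F_real a b h Hab ltac:(lra)).
    rewrite (RInt_ext_R _ g a b Hab) in D by (intros; apply Hg); exact D. }
  (* With one left endpoint kept fixed, the difference of two integrals of [g] is a difference of
     two values of [M]. *)
  destruct (limit_of_cauchy_at_infinity M) as [L HL].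
  { intros eps Heps; destruct (Hgi (eps / 2)) as [N HN]; [lra |].
    exists (Rmax N 0); intros b b' Hb Hb'.
    assert (L1 := Rmax_l N 0); assert (L2 := Rmax_r N 0).
    assert (B1 := HN (- Rmax N 0) b ltac:(lra) ltac:(lra)).
    assert (B2 := HN (- Rmax N 0) b' ltac:(lra) ltac:(lra)).
    rewrite HM in B1, B2 by lra.
    apply Rabs_le_between in B1, B2; apply Rabs_le; lra. }
  assert (I : forall x y, 0 <= y < h -> is_RInt_line (q x y) (2 * L - l - 2 * h * U x y)).
  { intros x y Hy.
    apply is_RInt_line_of_eps; [intros a b Hab; exact (proj1 (Iqp x y Hy a b Hab)) |].
    intros eps Heps; apply Hext.
    (* Writing [M b + M a] as twice [M b] minus the integral of [g], the errors add up as one, two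
       and one quarters of [eps]. *)
    destruct (Lim x y Hy (eps / 4)) as [N1 H1]; [lra |].
    destruct (Hgi (eps / 4)) as [N2 H2]; [lra |].
    destruct (HL (eps / 4)) as [N3 H3]; [lra |].
    exists (Rmax N1 (Rmax N2 N3)); intros a b Ha Hb Hab.
    assert (L1 := Rmax_l N1 (Rmax N2 N3)); assert (L2 := Rmax_r N1 (Rmax N2 N3)).
    assert (L3 := Rmax_l N2 N3); assert (L4 := Rmax_r N2 N3).
    assert (B1 := proj1 (H1 a b ltac:(lra) ltac:(lra)) Hab).
    assert (B2 := H2 a b ltac:(lra) ltac:(lra)); rewrite HM in B2 by exact Hab.
    assert (B3 := H3 b ltac:(lra)).
    apply Rabs_le_between in B1, B2, B3; apply Rabs_le; lra. }
  (* [M] tends to [L] at +oo and to [L - l] at -oo, so the constant is the mean of the two limiting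
     averages of [U] over the cross section. *)
  exists ((2 * L - l) / (2 * h)); split.
  + intros x y Hy.
    destruct (RInt_line_of_is (fun t => conj_poisson_kernel h (x - t) y * g t)
      (U x y - (2 * L - l) / (2 * h))) as [E1 E2].
    (* The contour produces [t - x] where the convolution has [x - t]; oddness of [sinh] accounts
       for the minus sign. *)
    { apply is_RInt_line_scal_ext with (1 := I x y ltac:(lra)) (c := - (1 / (2 * h)));
        [| field; lra].
      intros t; unfold q, conj_poisson_kernel; rewrite Hkt, cosh_opp, sinh_opp, Hk.
      unfold Rdiv; ring. }
    split; [exact E1 |].
    change (U x y = RInt_line (fun t => conj_poisson_kernel h (x - t) y * g t)
      + (2 * L - l) / (2 * h)); rewrite E2; ring.
  + intros x.
    assert (J : is_RInt_line (fun t => tanh (PI * (x - t) / (2 * h)) * g t)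
      (2 * h * U x 0 - (2 * L - l))).
    { apply is_RInt_line_scal_ext with (1 := I x 0 ltac:(lra)) (c := - 1); [| ring].
      intros t; unfold q; rewrite Hkt, cosh_opp, sinh_opp, Hk, tanh_half.
      replace (2 * (PI * (x - t) / (2 * h))) with (PI * (x - t) / h) by (field; lra).
      replace (PI * 0 / h) with 0 by (field; lra); rewrite cos_0.
      unfold Rdiv; ring. }
    destruct (RInt_line_of_is
      (fun t => 1 / (2 * h) * tanh (PI * (x - t) / (2 * h)) * g t)
      (U x 0 - (2 * L - l) / (2 * h))) as [E1 E2].
    { apply is_RInt_line_scal_ext with (1 := J) (c := 1 / (2 * h)); [| field; lra].
      intros t; ring. }
    destruct (RInt_line_of_is _ _ J) as [_ E3].
    split; [exact E1 | split].
    * change (U x 0 = RInt_line (fun t => 1 / (2 * h) * tanh (PI * (x - t) / (2 * h)) * g t)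
        + (2 * L - l) / (2 * h)); rewrite E2; ring.
    * rewrite E3; field; lra.
Qed.
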